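(* Fix a lattice path $\nu$, and let $L_1$ and $L_2$ be two alt $\nu$-Tamari lattices (that is, $L_1=\operatorname{Tam}_{\nu}(\delta)$ and $L_2=\operatorname{Tam}_{\nu}(\delta')$ for two increment vectors $\delta,\delta'$ with respect to $\nu$). Then there is a bijection $\Phi\colon L_1\to L_2$ such that: (1) $\Phi(\operatorname{row}(x))=\operatorname{row}(\Phi(x))$ for all $x\in L_1$; (2) $\sum_{y\in\{\operatorname{row}^j(x)\,:\,j\ge 0\}}\operatorname{ddeg}(y)=\sum_{y\in\{\operatorname{row}^j(x)\,:\,j\ge 0\}}\operatorname{ddeg}(\Phi(y))$ for all $x\in L_1$. Here $\operatorname{row}$ denotes rowmotion on the lattice in question and $\operatorname{ddeg}$ its down-degree statistic.
   Context: All posets are finite. Alt $\nu$-Tamari lattices. Lattice paths use unit east steps $E$ and north steps $N$. Write $\nu=E^{\nu_0}NE^{\nu_1}N\cdots NE^{\nu_n}$ and encode it as $(\nu_0,\dots,\nu_n)$, $\nu_i\ge 0$. A $\nu$-Dyck path is a lattice path with the same endpoints as $\nu$ lying weakly above $\nu$. An increment vector with respect to $\nu$ is a sequence $\delta=(\delta_1,\dots,\delta_n)$ of nonnegative integers with $\delta_i\le\nu_i$ for $1\le i\le n$. For a $\nu$-Dyck path $\mu$, the $\delta$-altitude of its lattice points is defined as follows: the starting point has altitude $0$, each east step decreases the altitude by $1$, and the $i$-th north step of $\mu$ increases it by $\delta_i$. For a valley $EN$ of $\mu$ (consecutive steps $E$ then $N$), let $p$ be the lattice point between these two steps, let $q$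 be the next lattice point of $\mu$ after $p$ with the same $\delta$-altitude as $p$, and let $\mu[p,q]$ be the subpath from $p$ to $q$. The $\delta$-rotation of $\mu$ at this valley is the path $\mu'$ obtained from $\mu$ by exchanging $\mu[p,q]$ with the east step immediately preceding it; write $\mu\lessdot_\delta\mu'$. The alt $\nu$-Tamari lattice $\operatorname{Tam}_{\nu}(\delta)$ is the set of $\nu$-Dyck paths ordered by the reflexive transitive closure of $\lessdot_\delta$; it is a semidistributive lattice whose cover relations are exactly the $\delta$-rotations. Rowmotion. A lattice $L$ is semidistributive if for all $x,y,z\in L$: $x\vee y=x\vee z$ implies $x\vee(y\wedge z)=x\vee y$, and $x\wedge y=x\wedge z$ implies $x\wedge(y\vee z)=x\wedge y$. In a semidistributive lattice $L$, for each cover relation $x\lessdot y$ the set $\{z\in L: z\vee x=y\}$ has a minimum element $j_{x,y}$, which is join-irreducible. Let $\mathcal D_L(x)=\{j_{w,x}:w\lessdot x\}$ and $\mathcal U_L(x)=\{j_{x,w}:x\lessdot w\}$. The maps $\mathcal D_L$ and $\mathcal U_L$ are injective on $L$ and have the same image, so there is a unique bijection $\operatorname{row}\colon L\to L$ (rowmotion) with $\mathcal U_L(x)=\mathcal D_L(\operatorname{row}(x))$ for all $x\in L$. The down-degree $\operatorname{ddeg}(x)$ is the number of elements of $L$ that $x$ covers. *)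

(* Defs.v *)
From HB Require Import structures.
From mathcomp Require Import all_boot all_order all_algebra.

Set Implicit Arguments.
Unset Strict Implicit.
Unset Printing Implicit Defensive.

Import Order.TTheory GRing.Theory.

Section Rowmotion.
Context {d : Order.disp_t} {L : finPOrderType d}.
Implicit Types x y z j w : L.
Local Open Scope order_scope.

Definition covers x y := (x < y) && ~~ [exists z, x < z < y].

Definition is_join x y z :=
  [&& x <= z, y <= z & [forall u, (x <= u) && (y <= u) ==> (z <= u)]].

(** [label x y j]: j is the minimum of [{z | z \/ x = y}]; for [covers x y] in
    a semidistributive lattice this says that j is the element j_{x,y}. *)
Definition label x y j :=
  is_join j x y && [forall z, is_join z x y ==> (j <= z)].

Definition down_labels x : {set L} :=
  [set j | [exists w, covers w x && label w x j]].

Definition up_labels x : {set L} :=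
  [set j | [exists w, covers x w && label x w j]].

(** The default value is never used when L is a semidistributive lattice:
    there [down_labels] and [up_labels] are injective with the same image, so
    exactly one y qualifies. *)
Definition rowmotion x : L :=
  odflt x [pick y | up_labels x == down_labels y].

Definition ddeg x : nat := #|[set w | covers w x]|.

End Rowmotion.

(** A lattice path is its sequence of steps, read from its starting point,
    with [false] for an east step E and [true] for a north step N. *)

Local Notation E := false.
Local Notation N := true.

(** [path_of [:: nu_0; ..; nu_n]] is E^{nu_0} N E^{nu_1} N .. N E^{nu_n}. *)
Definition path_of (nu : seq nat) : seq bool :=
  nseq (head 0 nu) E ++ flatten [seq N :: nseq k E | k <- behead nu].

(** For two paths with common starting point and the same length: after k
    steps both are on the antidiagonal x + y = k, where mu must not be below
    nu. *)
Definition weakly_above (mu nu : seq bool) : bool :=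
  [forall k : 'I_(size nu).+1,
     count_mem N (take k nu) <= count_mem N (take k mu)].

Definition dyck (nu : seq nat) (mu : seq bool) : bool :=
  [&& count_mem E mu == count_mem E (path_of nu),
      count_mem N mu == count_mem N (path_of nu)
    & weakly_above mu (path_of nu)].

(** Fixing the length, which is implied by [dyck], gives a finite type. *)
Definition dyck_path (nu : seq nat) : Type :=
  {mu : (size (path_of nu)).-tuple bool | dyck nu mu}.

HB.instance Definition _ nu := Finite.on (dyck_path nu).

(** delta = (delta_1, .., delta_n) is indexed from 0: the component of index i
    is delta_{i+1}, to be compared with nu_{i+1}. *)
Definition increment_vector n (nu : n.+1.-tuple nat) (delta : n.-tuple nat) :=
  [forall i : 'I_n, tnth delta i <= tnth nu (lift ord0 i)].

(** The delta-altitude of the lattice point of mu reached after k steps. *)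
Definition altitude (delta : seq nat) (mu : seq bool) (k : nat) : int :=
  (Posz (\sum_(i < count_mem N (take k mu)) nth 0 delta i)
     - Posz (count_mem E (take k mu)))%R.

(** There is a valley formed by the steps k and k + 1 (counted from 0), hence
    p is reached after k + 1 steps, and q after m steps. *)
Definition rotation (delta : seq nat) (mu mu' : seq bool) : bool :=
  [exists k : 'I_(size mu), exists m : 'I_(size mu).+1,
    [&& nth N mu k == E, nth E mu k.+1 == N,
        k.+1 < m, altitude delta mu m == altitude delta mu k.+1,
        [forall l : 'I_(size mu),
           (k.+1 < l < m) ==> (altitude delta mu l != altitude delta mu k.+1)]
      & mu' == take k mu ++ drop k.+1 (take m mu) ++ E :: drop m mu]].

(** An alias of [dyck_path nu]: delta selects the order put on it below. *)
Definition Tam n (nu : n.+1.-tuple nat) (delta : n.-tuple nat) : Type :=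
  dyck_path nu.

Fact Tam_display : Order.disp_t. Proof. exact: Order.Disp tt tt. Qed.

Lemma rotation_lexi delta mu mu' :
  rotation delta mu mu' -> (mu < mu' :> seqlexi bool)%O.
Proof.
case/existsP=> k /existsP[m /and5P[/eqP muk /eqP muk1 km _ /andP[_ /eqP->]]].
have ltk : k.+1 < size mu.
  by rewrite ltnNge; apply/negP => /(nth_default E); rewrite muk1.
have ltk0 := ltnW ltk.
rewrite -[X in (X < _)%O](cat_take_drop k mu).
elim: (take k mu) => [|b s IHs] /=; last by rewrite Order.SeqLexiOrder.Exports.eqhead_ltxiE.
rewrite (drop_nth N) // muk.
have -> : drop k.+1 (take m mu) = N :: drop k.+2 (take m mu).
  rewrite (drop_nth E) ?nth_take ?muk1 // size_take.
  by case: ifP.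
by rewrite /= Order.SeqLexiOrder.Exports.ltxi_cons.
Qed.

Section TamOrder.
Variables (n : nat) (nu : n.+1.-tuple nat) (delta : n.-tuple nat).
Implicit Types x y : Tam nu delta.

HB.instance Definition _ := Finite.on (Tam nu delta).

Definition Tam_path x : seq bool := val x.

Definition Tam_rot : rel (Tam nu delta) :=
  fun x y => rotation delta (Tam_path x) (Tam_path y).

Definition Tam_le : rel (Tam nu delta) := connect Tam_rot.

Fact Tam_le_refl : reflexive Tam_le. Proof. exact: connect0. Qed.

Fact Tam_le_trans : transitive Tam_le. Proof. exact: connect_trans. Qed.

Fact Tam_le_anti : antisymmetric Tam_le.
Proof.
have le_lexi x y : Tam_le x y -> (Tam_path x <= Tam_path y :> seqlexi bool)%O.
  case/connectP=> p; elim: p x => [|z p IHp] x /=; first by move=> _ ->.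
  case/andP=> /rotation_lexi/ltW xz pz yE; exact: le_trans xz (IHp z pz yE).
move=> x y /andP[/le_lexi xy /le_lexi yx].
by apply/val_inj/val_inj/(@le_anti _ (seqlexi bool)); rewrite [X in X && _]xy yx.
Qed.

HB.instance Definition _ :=
  Order.Le_isPOrder.Build Tam_display (Tam nu delta)
    Tam_le_refl Tam_le_anti Tam_le_trans.

End TamOrder.

(* Main.v *)
Require Import Defs.
From mathcomp Require Import all_boot all_order all_algebra zify.

(** A path E^g_0 N E^g_1 .. N E^g_n is handled through the sequence of its gaps
    g_0, .., g_n. The increments define a matching on each path: the [i]-th north
    step opens delta_i units of altitude, each of them is closed by a later east
    step, and the east steps that close nothing are said to be at base level. In
    this way every east step has a name, and a rotation moves one east step,
    without changing any name, across a part of the path that begins with the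
    north step of a valley. The order is then the componentwise order of the
    numbers of north steps before each east step ([reach_down_label]), and a
    rotation carries the label (i, e), where [e] is the name of the moving step
    and [i] the index, from 0, of the north step. The join-irreducible element j_{x,y} of
    a cover is the least path in which more than [i] north steps precede [e]
    ([edge_label]), so that row x is the unique path whose down labels are the up
    labels of x ([rowmotion_edges]).

    This gives a recursion for rowmotion ([row_gaps], [down_label_row]). Let s be
    the part of a path after its first gap g and its first north step, of
    increment d. Then row sends (g + 1, s) to (g, I_d (row s)), where I_d inserts
    an east step behind d base-level steps, and (0, s) to (h, t), where
    I_d^h t = row s with h as large as possible.

    Now row I_{m+1} = I_m row, since both sides have the same down labels
    ([row_gaps_insert]). Hence the map (g, s) |-> (g, row s) conjugates rowmotion
    for the first increment d + 1 to rowmotion for the first increment d, the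
    other increments being the same ([row_gaps_lower1]). After the first increment
    has become 0, the same is done in the tail, and finally all increments are 0
    ([straighten_row]). The bijection of the theorem goes from delta to 0 and back
    to delta'.

    Since row x has as many lower covers as x has upper covers, the sum of ddeg
    over an orbit is the sum of the numbers of valleys, a statistic of paths that
    does not involve delta ([ddeg_rowmotion]). Since I_{m+1} inserts an east step
    behind another one, it creates no valley, and therefore each conjugation
    above changes the number of valleys of x by b (row x) - b x for some function
    b; such a difference sums to 0 over an orbit. *)

Set Implicit Arguments.
Unset Strict Implicit.
Unset Printing Implicit Defensive.

Import Order.TTheory.

(** * Paths as sequences of gaps, and the names of their east steps *)

(** Everything below is an induction that cuts a path after its first north step.
So [x] and [nus] are the gaps of the remaining parts of a path and of nu, and
their sums may differ: [x] has [sumn x - sumn nus] extra east steps. The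
condition on tail sums says that [x] stays weakly above [nus] when the two are
aligned at their ends, and each increment is bounded by the gap of nu that
follows its north step. The first component, the list of increments, is one
shorter than the other two because it starts with the increment of the north
step that follows the first gap. *)
Inductive valid : seq nat -> seq nat -> seq nat -> Prop :=
| valid_last n g : n <= g -> valid [::] [:: n] [:: g]
| valid_cons d ds n nus g s : d <= head 0 nus -> n + sumn nus <= g + sumn s ->
    valid ds nus s -> valid (d :: ds) (n :: nus) (g :: s).

Lemma valid_consE d ds nus x : valid (d :: ds) nus x -> exists n nus' g s,
  [/\ nus = n :: nus', x = g :: s, d <= head 0 nus', n + sumn nus' <= g + sumn s
    & valid ds nus' s].
Proof.
by move=> H; inversion H; subst; exists n, nus0, g, s.
Qed.

Lemma valid_nilE nus x : valid [::] nus x -> exists n g, [/\ nus = [:: n], x = [:: g] & n <= g].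
Proof. by move=> H; inversion H; subst; exists n, g. Qed.

Lemma valid_sumn ds nus x : valid ds nus x -> sumn nus <= sumn x.
Proof. by case=> //= n g; rewrite !addn0. Qed.

Lemma sumn_head (s : seq nat) : sumn s = head 0 s + sumn (behead s).
Proof. by case: s. Qed.

Lemma valid_head ds nus x : valid ds nus x -> head 0 nus + sumn (behead nus) <= sumn x.
Proof. by move/valid_sumn; rewrite sumn_head. Qed.

(** An east step is at base level when no north step of the sequence opens a unit
of altitude that it closes. [insert ds m x] puts a new base-level east step
right after the [m]-th one. In [g :: s] the base level consists of the first
[g] east steps, then of the base level of [s] without its first [d] steps, which
close the north step in between; this explains the index [m - g + d]. *)
Fixpoint insert ds m x : seq nat :=
  match ds, x with
  | d :: ds', g :: s => if m <= g then g.+1 :: s else g :: insert ds' (m - g + d) s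
  | _, g :: s => g.+1 :: s
  | _, _ => [::]
  end.

Lemma sumn_insert ds nus m x : valid ds nus x -> sumn (insert ds m x) = (sumn x).+1.
Proof.
move=> okx; elim: okx m => //= d ds' n nus' g s _ _ _ IH m.
by case: leqP => //= _; rewrite IH addnS.
Qed.

Lemma valid_insert ds nus m x : valid ds nus x -> valid ds nus (insert ds m x).
Proof.
move=> okx; elim: okx m => /= [n g le_ng | d ds' n nus' g s le_d le_n oks IH] m.
  by apply: valid_last; lia.
case: leqP => _; apply: valid_cons => //=; first by lia.
by rewrite (sumn_insert _ oks); lia.
Qed.

(** The partial inverse of [insert]: base-level step number [m] (from 0) is removed
when it directly follows step number [m.-1], or starts the sequence, and the
result is still valid. *)
Fixpoint delete ds nus m x : option (seq nat) :=
  if sumn nus < sumn x then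
    match ds, x with
    | d :: ds', g :: s =>
        if m < g then Some (g.-1 :: s) else
        if m == g then None else omap (cons g) (delete ds' (behead nus) (m - g + d) s)
    | _, _ => Some [:: (head 0 x).-1]
    end
  else None.

Lemma insertK ds nus m x : valid ds nus x -> delete ds nus m (insert ds m x) = Some x.
Proof.
move=> okx; elim: okx m => /= [n g le_ng | d ds' n nus' g s le_d le_n oks IH] m.
  by case: ltnP => //; lia.
case: (leqP m g) => /= [le_mg|lt_gm].
  by case: ltnP => //=; [rewrite ifT | lia].
rewrite (sumn_insert _ oks) ifT; last by lia.
by rewrite ifF ?ifF ?IH //; lia.
Qed.

Lemma deleteP ds nus m x y : valid ds nus x -> delete ds nus m x = Some y ->
  valid ds nus y /\ insert ds m y = x.
Proof.
move=> okx; elim: okx m y => /= [n g le_ng | d ds' n nus' g s le_d le_n oks IH] m y.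
  case: ltnP => // lt_ng [<-]; split; first by apply: valid_last; lia.
  by congr [:: _]; lia.
case: ltnP => // lt_n; case: ltnP => [lt_mg [<-]|le_gm].
  by split; [apply: valid_cons => //; lia | rewrite /= ifT ?prednK //; lia].
case: eqP => // ne_mg; case Ed: delete => [v|] //= [<-].
have [okv insv] := IH _ _ Ed.
have := sumn_insert (m - g + d) okv; rewrite insv => sv.
split; first by apply: valid_cons => //; lia.
by rewrite /= ifF ?insv //; lia.
Qed.

(** East steps are named by pairs, counting from 0: [(j.+1, k)] is the [k]-th step among those that
close the [j]-th north step, [(0, k)] is the [k]-th base-level one. Inserting
after [m] base-level steps renames the later ones. *)
Definition shift_id m (e : nat * nat) := if (e.1 == 0) && (m <= e.2) then (0, e.2.+1) else e.

(** The name, in [g :: s], of the step called [e] in [s]. *)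
Definition outer_id d g (e : nat * nat) :=
  match e with
  | (0, k) => if k < d then (1, k) else (0, k - d + g)
  | (j.+1, k) => (j.+2, k)
  end.

Lemma outer_id_inj d g : injective (outer_id d g).
Proof.
move=> [[|j] k] [[|j'] k'] /=; (repeat case: ltnP => ?) => -[] *; try by [];
  by congr (_, _); lia.
Qed.

Lemma shift_id_neq m e : shift_id m e <> (0, m).
Proof. by case: e => [[|j] k]; rewrite /shift_id //=; case: leqP => ? -[] *; lia. Qed.

Lemma outer_shift_le d g m e : m <= g -> outer_id d g.+1 e = shift_id m (outer_id d g e).
Proof.
case: e => [[|j] k] le_mg; rewrite /shift_id //=; case: ltnP => //= ?.
by rewrite ifT; [congr (_, _) |]; lia.
Qed.

Lemma outer_shift_gt d g m e : g < m ->
  outer_id d g (shift_id (m - g + d) e) = shift_id m (outer_id d g e).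
Proof.
case: e => [[|j] k] lt_gm; rewrite /shift_id //=; case: (leqP (m - g + d) k) => /= ?.
  have -> : (k.+1 < d) = false by lia.
  have -> : (k < d) = false by lia.
  by rewrite /= ifT; [congr (_, _) |]; lia.
by case: ltnP => //= ?; rewrite ifF //; lia.
Qed.

Lemma outer_shift d g e : outer_id d g (shift_id d e) = outer_id d g.+1 e.
Proof.
case: e => [[|j] k]; rewrite /shift_id //=; case: (leqP d k) => /= [ledk|->] //.
by rewrite ltnNge leqW //=; congr (_, _); lia.
Qed.

Lemma outer_iter_shift d g h e : outer_id d g (iter h (shift_id d) e) = outer_id d (h + g) e.
Proof. by elim: h g => //= h IH g; rewrite outer_shift IH addnS. Qed.

(** The coordinates in which the alt nu-Tamari order turns out to be componentwise:
the number of north steps that precede the step [e]. The pairs [(1, k)] with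
[d <= k] name no step; a constant value keeps them out of all comparisons. *)
Fixpoint norths_before ds x (e : nat * nat) : nat :=
  match ds, x with
  | d :: ds', g :: s =>
    match e with
    | (0, k) => if k < g then 0 else (norths_before ds' s (0, k - g + d)).+1
    | (1, k) => if k < d then (norths_before ds' s (0, k)).+1 else 0
    | (j.+1, k) => (norths_before ds' s (j, k)).+1
    end
  | _, _ => 0
  end.

Lemma norths_before_outer d ds g s e : norths_before (d :: ds) (g :: s) (outer_id d g e)
  = (norths_before ds s e).+1.
Proof.
case: e => [[|j] k] //=; case: ltnP => /= [->//|ledk].
by rewrite ifF; [congr (norths_before _ _ (_, _)).+1 |]; lia.
Qed.

Lemma shift_id_ge m k : m <= k -> shift_id m (0, k) = (0, k.+1).
Proof. by rewrite /shift_id /= => ->. Qed.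

Lemma shift_id_lt m k : k < m -> shift_id m (0, k) = (0, k).
Proof. by rewrite /shift_id /= ltnNge => /negbTE ->. Qed.

Lemma norths_before_insert ds nus m x e : valid ds nus x ->
  norths_before ds (insert ds m x) (shift_id m e) = norths_before ds x e.
Proof.
move=> okx; elim: okx m e => //= d ds' n nus' g s _ _ _ IH m [[|[|j]] k]; last first.
- by case: (leqP m g) => //= _; rewrite -(IH (m - g + d) (j.+1, k)).
- case: (leqP m g) => //= lt_gm; case: ltnP => // lt_kd.
  by rewrite -(IH (m - g + d)) shift_id_lt //; lia.
case: (leqP m k) => [le_mk|lt_km]; rewrite ?(shift_id_ge le_mk) ?(shift_id_lt lt_km).
  case: (leqP m g) => [le_mg|lt_gm] /=; first by rewrite ltnS subSS.
  rewrite !ifF; [|lia|lia]; rewrite -(IH (m - g + d)) shift_id_ge; last by lia.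
  by congr (norths_before _ _ (_, _)).+1; lia.
case: (leqP m g) => [le_mg|lt_gm] /=; first by rewrite !ifT; lia.
by case: ltnP => // le_gk; rewrite -(IH (m - g + d)) shift_id_lt //; lia.
Qed.

(** * Rotations and their labels *)

(** A rotation carries one east step across a piece of path that starts and ends at
the same altitude, so matchings of east and north steps survive, and the moving
step keeps its name. The edge at the [i]-th north step is labelled by [i] and
that name. *)
Fixpoint up_label ds x i : option (nat * nat) :=
  match ds, x with
  | d :: ds', g :: s =>
    if i is i'.+1 then omap (outer_id d g) (up_label ds' s i')
    else if 0 < g then Some (0, g.-1) else None
  | _, _ => None
  end.

(** In the valley before the first north step, the step number [g.-1] of the base
level jumps over that north step and over all steps up to its return, which in
the tail are those up to base-level step number [d.-1]. *)
Fixpoint rotate ds i x : seq nat :=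
  match ds, x with
  | d :: ds', g :: s => if i is i'.+1 then g :: rotate ds' i' s else g.-1 :: insert ds' d s
  | _, _ => x
  end.

(** The first north step can be moved down again exactly when the east step after
its return was inserted there, that is, when it can be deleted from the tail. *)
Fixpoint down_label ds nus x i : option (nat * nat) :=
  match ds, x with
  | d :: ds', g :: s =>
    if i is i'.+1 then omap (outer_id d g) (down_label ds' (behead nus) s i')
    else if delete ds' (behead nus) d s is Some _ then Some (0, g) else None
  | _, _ => None
  end.

Lemma rotate_valid ds nus x i e : valid ds nus x -> up_label ds x i = Some e ->
  valid ds nus (rotate ds i x) /\ sumn (rotate ds i x) = sumn x.
Proof.
move=> okx; elim: okx i e => //= d ds' n nus' g s led len oks IH [|i] e.
  case: ltnP => // lt_0g _; split; last by rewrite /= (sumn_insert _ oks); lia.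
  by apply: valid_cons => //; [rewrite (sumn_insert _ oks); lia | apply: valid_insert].
case Ei: up_label => [e'|] //= _; have [oku su] := IH _ _ Ei.
by split; [apply: valid_cons => //; lia | rewrite su].
Qed.

(** The names that do not come from the tail have the same coordinate 0 whatever the
tail is, so only the former matter when tails are compared. *)
Lemma outer_or_norths_before0 d g e :
  (exists e1, e = outer_id d g e1) \/ forall ds s, norths_before (d :: ds) (g :: s) e = 0.
Proof.
case: e => [[|[|j]] k] /=; last by left; exists (j.+1, k).
  case: ltnP => [lt_kg|le_gk]; first by right.
  by left; exists (0, k - g + d); rewrite /= ifF; [congr (_, _) |]; lia.
by case: ltnP => lt_kd; [left; exists (0, k); rewrite /= lt_kd | right].
Qed.

(** Matchings, hence names, survive the rotation, so the coordinates of the steps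
that stay in place do not change. *)
Lemma norths_before_rotate ds nus x i e : valid ds nus x -> up_label ds x i = Some e ->
  [/\ norths_before ds x e = i, i < norths_before ds (rotate ds i x) e
    & forall e', e' <> e -> norths_before ds (rotate ds i x) e' = norths_before ds x e'].
Proof.
move=> okx; elim: okx i e => [//|d ds' n nus' g s led len oks IH] [|i] e.
  case: g len => // g len [<-] /=; rewrite ltnSn ltnn; split=> // -[[|[|j]] k] ne /=.
  - case: (ltngtP k g) => [lt_kg|lt_gk|eq_kg]; last by case: ne; rewrite eq_kg.
      by rewrite ltnS ltnW.
    rewrite ltnS leqNgt lt_gk /= -(norths_before_insert d _ oks) shift_id_ge; last by lia.
    by congr (norths_before _ _ (_, _)).+1; lia.
  - by case: ltnP => // lt_kd; rewrite -(norths_before_insert d (0, k) oks) shift_id_lt.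
  - by rewrite -(norths_before_insert d (j.+1, k) oks).
rewrite [up_label _ _ _]/= [rotate _ _ _]/=; case Ei: up_label => [e'|] //= [<-].
have [c1 c2 c3] := IH _ _ Ei.
rewrite -/(norths_before (d :: ds') (g :: s) _).
rewrite -/(norths_before (d :: ds') (g :: _) (outer_id d g e')).
rewrite !norths_before_outer c1 ltnS; split=> // e1 ne.
rewrite -/(norths_before (d :: ds') (g :: s) _) -/(norths_before (d :: ds') (g :: _) e1).
have [[e2 E2]|c0] := outer_or_norths_before0 d g e1; last by rewrite !c0.
by rewrite E2 !norths_before_outer c3 // => E; case: ne; rewrite E2 E.
Qed.

Lemma down_label_rotate ds nus x i e : valid ds nus x -> up_label ds x i = Some e ->
  down_label ds nus (rotate ds i x) i = Some e.
Proof.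
move=> okx; elim: okx i e => //= d ds' n nus' g s led len oks IH [|i] e.
  by case: ltnP => // lt_0g [<-]; rewrite (insertK _ oks).
by case Ei: up_label => [e'|] //= [<-]; rewrite (IH _ _ Ei).
Qed.

Lemma down_label_ex ds nus y i e : valid ds nus y -> down_label ds nus y i = Some e ->
  exists x, [/\ valid ds nus x, sumn x = sumn y, up_label ds x i = Some e & rotate ds i x = y].
Proof.
move=> oky; elim: oky i e => //= d ds' n nus' g s led len oks IH [|i] e.
  case Ed: delete => [v|] //= [<-]; have [okv insv] := deleteP oks Ed.
  have := sumn_insert d okv; rewrite insv => sv.
  exists (g.+1 :: v); split=> //=; last by rewrite insv.
    by apply: valid_cons => //; lia.
  by lia.
case Ed: down_label => [e'|] //= [<-]; have [x [okx sx ux upx]] := IH _ _ Ed.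
exists (g :: x); split=> //=; last by rewrite upx.
- by apply: valid_cons => //; lia.
- by rewrite sx.
by rewrite ux.
Qed.

Lemma rotate_inj ds nus x x' i e e' : valid ds nus x -> valid ds nus x' ->
  up_label ds x i = Some e -> up_label ds x' i = Some e' ->
  rotate ds i x = rotate ds i x' -> x = x'.
Proof.
move=> okx; elim: okx x' i e e' => //= d ds' n nus' g s led len oks IH x' i e e'.
move=> /valid_consE [n1 [nus1 [g' [s' [[<- <-] -> _ _ oks']]]]] /=.
case: i => [|i].
  case: ltnP => // lt_g _; case: ltnP => // lt_g' _ [eqg eqs].
  have /Some_inj -> : Some s = Some s' by rewrite -(insertK d oks) eqs (insertK d oks').
  by congr (_ :: _); lia.
case E1: up_label => [e1|] //= _; case E2: up_label => [e2|] //= _ [<- eqs].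
by rewrite (IH _ _ _ _ oks' E1 E2 eqs).
Qed.

(** The step inserted at [b] lies beyond the place [a] where the deletion happens.
The two bounds on [sumn u] guarantee that the recursion of [delete] never meets
a tail without extra steps, in which validity would forbid the deletion for [u]
and allow it after the insertion. *)
Lemma delete_insert ds nus a b u : valid ds nus u -> a < b -> a + sumn (behead nus) < sumn u ->
  sumn nus < sumn u -> isSome (delete ds nus a (insert ds b u)) = isSome (delete ds nus a u).
Proof.
move=> oku; elim: oku a b => /= [n g le_ng|d ds' n nus' g s led len oks IH] a b lt_ab.
  by move=> _ lt_ng; rewrite !ifT //; lia.
move=> lta ltn; rewrite ltn; have := sumn_head nus'.
case: (leqP b g) => /= [le_bg|lt_gb] sh.
  by do 3?[rewrite ifT; last by lia].
rewrite ifT; last by rewrite (sumn_insert _ oks); lia.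
case: ltnP => // le_ga; case: eqP => // ne_ag.
have := IH (a - g + d) (b - g + d); case: delete => [?|]; case: delete => [?|] //=; apply; lia.
Qed.

(** No north step stands between an inserted step and the base-level step before it,
so no edge is gained or lost. The bound on [m] says that the new step is inserted
among those that precede the first north step in the lowest valid sequence. *)
Lemma down_label_insert ds nus m x i : valid ds nus x -> m + sumn (behead nus) <= sumn x ->
  down_label ds nus (insert ds m x) i = omap (shift_id m) (down_label ds nus x i).
Proof.
move=> okx; elim: okx m i => //= d ds' n nus' g s led len oks IH m i lem.
have sh := sumn_head nus'.
case: (leqP m g) => [le_mg|lt_gm] /=; case: i => [|i] /=.
- by case: delete => //= _; rewrite /shift_id /= le_mg.
- by case: down_label => //= e; rewrite (outer_shift_le _ _ le_mg).
- have : isSome (delete ds' nus' d (insert ds' (m - g + d) s)) = isSome (delete ds' nus' d s).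
    by apply: (delete_insert oks); lia.
  by case: delete => [?|]; case: delete => [?|] //= _; rewrite shift_id_lt.
- rewrite IH; last by lia.
  by case: down_label => //= e; rewrite (outer_shift_gt _ _ lt_gm).
Qed.

(** Either nothing stands directly before the base-level step number [m], which can
then be deleted, or the last of the trees of north steps standing there returns
to its altitude just before that step, and can be moved down across it. The
bounds exclude the steps that validity forces to be after a north step. *)
Lemma delete_or_down_label ds nus m x : valid ds nus x -> m + sumn (behead nus) < sumn x ->
  sumn nus < sumn x ->
  isSome (delete ds nus m x) \/ exists i, down_label ds nus x i = Some (0, m).
Proof.
move=> okx; elim: okx m => /= [n g le_ng|d ds' n nus' g s led len oks IH] m.
  by move=> _ ltn; left; rewrite ltn.
move=> ltm ltn; have sh := sumn_head nus'; rewrite ltn.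
case: ltngtP => [lt_mg|lt_gm|eq_mg]; first by left.
  have [||H|[i Hi]] := IH (m - g + d); [lia|lia| |].
    by left; move: H; case: delete.
  right; exists i.+1; rewrite /= Hi /=; rewrite ifF; last by lia.
  by congr (Some (_, _)); lia.
right; have [||H|[i Hi]] := IH d; [lia|lia| |].
  by exists 0; move: H; case: delete => // ? _; rewrite eq_mg.
by exists i.+1; rewrite /= Hi /= ltnn subnn eq_mg.
Qed.

Lemma iter_insert_valid ds nus d k x : valid ds nus x ->
  valid ds nus (iter k (insert ds d) x) /\ sumn (iter k (insert ds d) x) = k + sumn x.
Proof.
move=> okx; elim: k => //= k [oki si]; split; first exact: valid_insert.
by rewrite (sumn_insert _ oki) si.
Qed.

Lemma down_label_iter_insert ds nus d k x i : valid ds nus x -> d <= head 0 nus ->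
  down_label ds nus (iter k (insert ds d) x) i = omap (iter k (shift_id d)) (down_label ds nus x i).
Proof.
move=> okx led; elim: k => [|k IH] /=; first by case: down_label.
have [oki _] := iter_insert_valid d k okx.
rewrite (down_label_insert _ oki) ?IH; first by case: down_label.
by have := valid_head oki; lia.
Qed.

Inductive reach (ds : seq nat) : seq nat -> seq nat -> Prop :=
| reach0 x : reach ds x x
| reachS x i e y : up_label ds x i = Some e -> reach ds (rotate ds i x) y -> reach ds x y.

Lemma reach_trans ds x y z : reach ds x y -> reach ds y z -> reach ds x z.
Proof. by elim=> // {}x i e {}y ui _ IH /IH; apply: reachS ui. Qed.

Lemma reach_cons d ds g s t : reach ds s t -> reach (d :: ds) (g :: s) (g :: t).
Proof.
elim=> [x|x i e y ui _ IH]; first exact: reach0.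
by apply: (@reachS _ _ i.+1 (outer_id d g e)); rewrite //= ui.
Qed.

Lemma reach_head d ds k g s : reach (d :: ds) (k + g :: s) (g :: iter k (insert ds d) s).
Proof.
elim: k s => [|k IH] s; first exact: reach0.
by rewrite iterSr; apply: (@reachS _ _ 0 (0, k + g)) => //=; apply: IH.
Qed.

(** If [h < g], a path with first gap [h] is not below one with first gap [g], and
some label witnesses it: step number [h] follows a north step in the first path
but not in the second. *)
Lemma down_label_lt_head d ds nus h t g s :
  valid (d :: ds) nus (h :: t) -> valid (d :: ds) nus (g :: s) ->
  h + sumn t = g + sumn s -> h < g -> exists i, down_label (d :: ds) nus (h :: t) i = Some (0, h).
Proof.
move=> /valid_consE [n [nus' [_ [_ [-> [<- <-] led _ okt]]]]].
move=> /valid_consE [_ [_ [_ [_ [[<- <-] [<- <-] _ _ oks]]]]] eqs lthg.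
have sh := sumn_head nus'; have ss := valid_sumn oks.
have [||H|[i Hi]] := delete_or_down_label (m := d) okt; [lia|lia| |].
  by exists 0; rewrite /=; case: delete H.
by exists i.+1; rewrite /= Hi /= ltnn subnn.
Qed.

Lemma down_label_base_ge d ds nus g s i k :
  down_label (d :: ds) nus (g :: s) i = Some (0, k) -> g <= k.
Proof.
case: i => [|i] /=; first by case: delete => // _ [->].
case: down_label => [[[|j] k']|] //=; case: ltnP => // _ [<-]; lia.
Qed.

Lemma down_label_inj ds nus x y : valid ds nus x -> valid ds nus y -> sumn x = sumn y ->
  down_label ds nus x =1 down_label ds nus y -> x = y.
Proof.
move=> okx; elim: okx y => [n g _|d ds' n nus' g s led len oks IH] y.
  by move=> /valid_nilE [_ [h [_ -> _]]] /=; rewrite !addn0 => ->.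
move=> oky; have okx : valid (d :: ds') (n :: nus') (g :: s) by apply: valid_cons.
have [_ [_ [h [t [[<- <-] E _ _ okt]]]]] := valid_consE oky.
move: E oky => -> oky eqs eqd.
have eqgh : g = h.
  case: (ltngtP g h) => // [lt_gh|lt_hg]; exfalso.
    have [i Hi] := down_label_lt_head okx oky eqs lt_gh.
    by move: Hi; rewrite eqd => /down_label_base_ge; rewrite leqNgt lt_gh.
  have [i Hi] := down_label_lt_head oky okx (esym eqs) lt_hg.
  by move: Hi; rewrite -eqd => /down_label_base_ge; rewrite leqNgt lt_hg.
subst h; congr (_ :: _); apply: IH => //; first by move: eqs => /=; lia.
move=> i; have := eqd i.+1 => /=.
by case: down_label => [?|]; case: down_label => [?|] //= [/outer_id_inj ->].
Qed.

(** An element is the join of the labels of its lower covers: whatever satisfies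
the constraints given by these labels lies above it. Since labels say only what
coordinates must exceed, this also yields that the order is componentwise. *)
Lemma reach_down_label ds nus y z : valid ds nus y -> valid ds nus z -> sumn y = sumn z ->
  (forall i e, down_label ds nus y i = Some e -> i < norths_before ds z e) -> reach ds y z.
Proof.
elim: ds nus y z => [|d ds' IH] nus y z.
  move=> /valid_nilE [_ [g [_ -> _]]] /valid_nilE [_ [g' [_ -> _]]] /=; rewrite !addn0 => -> _.
  exact: reach0.
move=> oky okz; have [n [nus' [h [t [Enu E led len okt]]]]] := valid_consE oky.
move: Enu E oky okz => -> -> oky okz.
have [_ [_ [g [s [[<- <-] E _ _ oks]]]]] := valid_consE okz.
move: E okz => -> okz eqs sat.
have le_gh : g <= h.
  rewrite leqNgt; apply/negP => lt_hg.
  have [i Hi] := down_label_lt_head oky okz eqs lt_hg.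
  by have := sat _ _ Hi; rewrite /= lt_hg.
(* the first north step goes to its final place before the tail moves *)
apply: (@reach_trans _ _ (g :: iter (h - g) (insert ds' d) t)).
  by rewrite -{1}(subnK le_gh); apply: reach_head.
have [oki si] := iter_insert_valid d (h - g) okt; apply: reach_cons; apply: (IH nus') => //.
  by move: eqs => /=; lia.
move=> i e; rewrite (down_label_iter_insert _ _ okt) //; case Ei: down_label => [e'|] //= [<-].
have := sat i.+1 (outer_id d h e'); rewrite /= Ei => /(_ erefl).
rewrite -/(norths_before (d :: ds') (g :: s) (outer_id d h e')).
by rewrite -{1}(subnK le_gh) -outer_iter_shift norths_before_outer ltnS.
Qed.

(** Two north steps cannot return to their altitude directly before the same east
step: both would start at the altitude of that point, so the earlier one would
return no later than where the later one starts. *)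
Lemma down_label_pos_inj ds nus y i i' e : valid ds nus y ->
  down_label ds nus y i = Some e -> down_label ds nus y i' = Some e -> i = i'.
Proof.
move=> oky; elim: oky i i' e => //= d ds' n nus' h t led len okt IH.
have no k : isSome (delete ds' nus' d t) -> down_label ds' nus' t k <> Some (0, d).
  case Ed: delete => [v|] // _; have [okv <-] := deleteP okt Ed.
  rewrite (down_label_insert _ okv); last by have := valid_head okv; lia.
  by case: down_label => //= e [/shift_id_neq].
have l0 e : outer_id d h e = (0, h) -> e = (0, d).
  by move=> E; apply: (@outer_id_inj d h); rewrite E /= ltnn subnn.
case=> [|i] [|i'] e //=.
- case Ed: delete => [v|] // [<-]; case Ei: down_label => [e'|] //= [/l0 Ee].
  by case: (no i'); rewrite ?Ed // Ei Ee.
- case Ei: down_label => [e'|] //= [<-]; case Ed: delete => [v|] // [/esym/l0 Ee].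
  by case: (no i); rewrite ?Ed // Ei Ee.
case Ei: down_label => [e1|] //= [<-]; case Ei': down_label => [e2|] //= [/outer_id_inj E2].
by rewrite (IH i i' e1) // Ei' E2.
Qed.


(** * Rowmotion on gap sequences *)

Fixpoint strip ds nus m k x : nat * seq nat :=
  if k is k'.+1 then
    if delete ds nus m x is Some y then
      let: (h, t) := strip ds nus m k' y in (h.+1, t)
    else (0, x)
  else (0, x).

Lemma delete_sumn0 ds nus m x : sumn x = 0 -> delete ds nus m x = None.
Proof. by case: ds => [|d ds] /= ->. Qed.

Lemma stripP ds nus m x : valid ds nus x ->
  let: (h, t) := strip ds nus m (sumn x) x in
  [/\ valid ds nus t, iter h (insert ds m) t = x & delete ds nus m t = None].
Proof.
move: {-1}(sumn x) (leqnn (sumn x)) => k; elim: k x => [|k IH] x le_k okx /=.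
  by split=> //; apply: delete_sumn0; lia.
case Ed: delete => [y|] //=; have [oky insy] := deleteP okx Ed.
have := sumn_insert m oky; rewrite insy => sy.
have := IH y; case: strip => h t /(_ _ oky) [|okt it dt]; first by lia.
by split=> //=; rewrite it.
Qed.

Lemma strip_iter_insert ds nus m h t : valid ds nus t -> delete ds nus m t = None ->
  strip ds nus m (sumn (iter h (insert ds m) t)) (iter h (insert ds m) t) = (h, t).
Proof.
move=> okt dt; have [okh sh] := iter_insert_valid m h okt; rewrite sh {okh sh}.
elim: h => [|h IH] /=; first by case: sumn => //= k; rewrite dt.
have [okh sh] := iter_insert_valid m h okt.
by rewrite (insertK _ okh) IH.
Qed.

(** The recursion is dictated by [down_label_row]. If the first gap is [g'.+1], the
first north step has a rotation labelled by step [g'], so in the image it must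
be possible to move it down across that step: an extra step follows its return.
If the first gap is 0, that north step must not be movable down, and all the
steps that would allow it have to be moved before it. *)
Fixpoint row_gaps ds nus x : seq nat :=
  match ds, x with
  | d :: ds', g :: s =>
    let s' := row_gaps ds' (behead nus) s in
    if g is g'.+1 then g' :: insert ds' d s'
    else let: (h, t) := strip ds' (behead nus) d (sumn s') s' in h :: t
  | _, _ => x
  end.

Variant row0_spec d ds nus s : seq nat -> Prop :=
  Row0Spec h t of valid ds nus t & h + sumn t = sumn s & iter h (insert ds d) t = row_gaps ds nus s
    & delete ds nus d t = None : row0_spec d ds nus s (h :: t).

Lemma row_gaps_valid ds nus x : valid ds nus x ->
  valid ds nus (row_gaps ds nus x) /\ sumn (row_gaps ds nus x) = sumn x.
Proof.
move=> okx; elim: okx => [n g le_ng|d ds' n nus' g s led len oks [okr sr]] /=.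
  by split=> //; apply: valid_last.
case: g len => [|g] len /=; last first.
  rewrite (sumn_insert _ okr) sr; split; last by lia.
  by apply: valid_cons => //; [rewrite (sumn_insert _ okr); lia | apply: valid_insert].
have := stripP d okr; case: strip => h t [okt it dt].
have [_ st] := iter_insert_valid d h okt; rewrite it sr in st.
by split=> /=; [apply: valid_cons => //; lia | lia].
Qed.

Lemma row0P d ds n nus s : valid ds nus s ->
  row0_spec d ds nus s (row_gaps (d :: ds) (n :: nus) (0 :: s)).
Proof.
move=> oks /=; have [okr sr] := row_gaps_valid oks.
have := stripP d okr; case: strip => h t [okt it dt].
have [_ st] := iter_insert_valid d h okt; rewrite it sr in st.
by apply: Row0Spec.
Qed.

Lemma row0_eq d ds n nus s h t : valid ds nus t -> iter h (insert ds d) t = row_gaps ds nus s ->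
  delete ds nus d t = None -> row_gaps (d :: ds) (n :: nus) (0 :: s) = h :: t.
Proof. by move=> okt /= <- dt; rewrite strip_iter_insert. Qed.

(** This characterizes rowmotion, by [down_label_inj]. *)
Lemma down_label_row ds nus x i : valid ds nus x ->
  down_label ds nus (row_gaps ds nus x) i = up_label ds x i.
Proof.
move=> okx; elim: okx i => // d ds' n nus' g s led len oks IH i.
have [okr sr] := row_gaps_valid oks.
case: g len => [|g] len.
  case: row0P => // h t okt _ it dt; case: i => [|i] /=; first by rewrite dt.
  rewrite -IH -it (down_label_iter_insert _ _ okt) //; case: down_label => //= e.
  by rewrite outer_iter_shift addn0.
case: i => [|i] /=; first by rewrite (insertK _ okr).
rewrite (down_label_insert _ okr); last by have := valid_head okr; lia.
by rewrite IH; case: up_label => //= e; rewrite outer_shift.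
Qed.

Fixpoint unrow_gaps ds nus y : seq nat :=
  match ds, y with
  | d :: ds', h :: t =>
    if delete ds' (behead nus) d t is Some v then h.+1 :: unrow_gaps ds' (behead nus) v
    else 0 :: unrow_gaps ds' (behead nus) (iter h (insert ds' d) t)
  | _, _ => y
  end.

Lemma row_gapsK ds nus x : valid ds nus x -> unrow_gaps ds nus (row_gaps ds nus x) = x.
Proof.
move=> okx; elim: okx => // d ds' n nus' g s led len oks IH.
case: g len => [|g] len.
  by case: row0P => //= h t okt _ it ->; rewrite it IH.
by have [okr _] := row_gaps_valid oks; rewrite /= (insertK _ okr) IH.
Qed.


Lemma unrow_gapsP ds nus y : valid ds nus y -> [/\ valid ds nus (unrow_gaps ds nus y),
  sumn (unrow_gaps ds nus y) = sumn y & row_gaps ds nus (unrow_gaps ds nus y) = y].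
Proof.
elim: ds nus y => [|d ds IH] nus y.
  by move=> oky; split=> //; have [n [g [-> -> _]]] := valid_nilE oky.
move=> /valid_consE [n [nus' [h [t [-> -> led len okt]]]]] /=.
case Ed: delete => [v|] /=.
  have [okv insv] := deleteP okt Ed; have [oku su ru] := IH _ _ okv.
  have := sumn_insert d okv; rewrite insv => sv.
  by split; [apply: valid_cons|..]; rewrite /= ?su ?ru ?insv ?sv //; lia.
have [okh sh] := iter_insert_valid d h okt; have [oku su ru] := IH _ _ okh.
split; [by apply: valid_cons => //; lia | by lia |].
by apply: row0_eq; rewrite ?ru.
Qed.

(** * Trading increments for powers of rowmotion *)

Lemma row_gaps_inj ds nus x y : valid ds nus x -> valid ds nus y ->
  row_gaps ds nus x = row_gaps ds nus y -> x = y.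
Proof. by move=> okx oky E; rewrite -(row_gapsK okx) E row_gapsK. Qed.

Lemma up_label_insert ds nus m x i : valid ds nus x ->
  up_label ds (insert ds m.+1 x) i = omap (shift_id m) (up_label ds x i).
Proof.
move=> okx; elim: okx m i => // d ds' n nus' g s led len oks IH m i /=.
case: (ltnP m g) => [lt_mg|le_gm]; case: i => [|i] /=.
- by case: g lt_mg {len} => //= g lt_mg; rewrite shift_id_ge.
- by case: up_label => //= e; rewrite (outer_shift_le _ _ (ltnW lt_mg)).
- by case: (ltnP 0 g) => //= lt0g; rewrite shift_id_lt //; lia.
have -> : m.+1 - g + d = (m - g + d).+1 by lia.
rewrite IH; case: up_label => //= e.
case: (ltngtP g m) le_gm => // [lt_gm|->] _; first by rewrite outer_shift_gt.
by rewrite subnn add0n outer_shift (outer_shift_le _ _ (leqnn m)).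
Qed.

(** Compare labels: after an insertion behind [m.+1] base-level steps, a label which
named step [m] names the new step [m.+1], so the names in up labels move from
[m] on. Among down labels this is the effect of an insertion behind [m] steps. *)
Lemma row_gaps_insert ds nus m x : valid ds nus x -> m < head 0 nus ->
  row_gaps ds nus (insert ds m.+1 x) = insert ds m (row_gaps ds nus x).
Proof.
move=> okx ltm; have [okr sr] := row_gaps_valid okx.
have oki := valid_insert m.+1 okx; have [okri sri] := row_gaps_valid oki.
apply: down_label_inj okri (valid_insert m okr) _ _.
  by rewrite sri (sumn_insert _ okx) (sumn_insert _ okr) sr.
move=> i; rewrite (down_label_row _ oki) (up_label_insert _ _ okx) (down_label_insert _ okr).
  by rewrite (down_label_row _ okx).
by have := valid_head okr; lia.
Qed.

(** The number of rotations starting at [x], when it has [n.+1] gaps; it does not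
depend on the increments. *)
Definition valleys n x := count (fun g => 0 < g) (take n x).

(** An east step inserted right after another one creates no valley. *)
Lemma valleys_insert ds nus m x : valid ds nus x ->
  valleys (size ds) (insert ds m.+1 x) = valleys (size ds) x.
Proof.
rewrite /valleys; move=> okx; elim: okx m => //= d ds' n nus' g s led len oks IH m /=.
case: (ltnP m g) => [lt_mg|le_gm] /=; first by have -> : 0 < g by lia.
have -> : m.+1 - g + d = (m - g + d).+1 by lia.
by rewrite IH.
Qed.

Lemma valleys_iter_insert ds nus m h x : valid ds nus x ->
  valleys (size ds) (iter h (insert ds m.+1) x) = valleys (size ds) x.
Proof.
move=> okx; elim: h => //= h IH; have [okh _] := iter_insert_valid m.+1 h okx.
by rewrite (valleys_insert _ okh).
Qed.

Lemma row_gaps_iter_insert ds nus m h x : valid ds nus x -> m < head 0 nus ->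
  row_gaps ds nus (iter h (insert ds m.+1) x) = iter h (insert ds m) (row_gaps ds nus x).
Proof.
move=> okx ltm; elim: h => //= h IH; have [okh _] := iter_insert_valid m.+1 h okx.
by rewrite (row_gaps_insert okh) // IH.
Qed.

(** Replacing the tail by its own rowmotion turns rowmotion for the increment [d.+1]
into rowmotion for [d], because [row_gaps_insert] turns insertions behind [d.+1]
steps into insertions behind [d] steps. These
insertions create no valley in the tail. *)
Lemma row_gaps_lower1 d ds n nus g s : d < head 0 nus -> valid ds nus s -> exists h t,
  [/\ valid ds nus t, row_gaps (d.+1 :: ds) (n :: nus) (g :: s) = h :: t,
      row_gaps (d :: ds) (n :: nus) (g :: row_gaps ds nus s) = h :: row_gaps ds nus t
    & valleys (size ds) t = valleys (size ds) (row_gaps ds nus s)].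
Proof.
move=> ltd oks; have [okr sr] := row_gaps_valid oks; case: g => [|g]; last first.
  exists g, (insert ds d.+1 (row_gaps ds nus s)); split=> //=; first exact: valid_insert.
    by rewrite (row_gaps_insert okr).
  exact: valleys_insert okr.
case: row0P => // h t okt _ it dt; exists h, t; split=> //; last first.
  by rewrite -it (valleys_iter_insert _ _ okt).
have [okrt _] := row_gaps_valid okt.
(* a place free for deletion in [row t] would come, rowmotion being onto, from
   one in [t] *)
apply: row0_eq => //; first by rewrite -it (row_gaps_iter_insert _ okt).
case Ed: delete => [v|] //; have [okv insv] := deleteP okrt Ed.
have [oku _ ru] := unrow_gapsP okv.
suff E : t = insert ds d.+1 (unrow_gaps ds nus v) by rewrite E (insertK _ oku) in dt.
by apply: (row_gaps_inj okt (valid_insert _ oku)); rewrite (row_gaps_insert oku) // ru insv.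
Qed.

Lemma iter_row_gaps_valid ds nus k x : valid ds nus x ->
  valid ds nus (iter k (row_gaps ds nus) x) /\ sumn (iter k (row_gaps ds nus) x) = sumn x.
Proof.
move=> okx; elim: k => //= k [oki si]; have [okr sr] := row_gaps_valid oki.
by rewrite sr si.
Qed.

(** The [d]-fold iteration of [row_gaps_lower1]. In the identity between valleys,
the sums on the two sides are values of one function at [g :: s] and at its
image, whose tail is [t]; thus they cancel when summed over an orbit. *)
Lemma row_gaps_lower d ds n nus g s : d <= head 0 nus -> valid ds nus s -> exists h t,
  [/\ valid ds nus t, row_gaps (d :: ds) (n :: nus) (g :: s) = h :: t,
      row_gaps (0 :: ds) (n :: nus) (g :: iter d (row_gaps ds nus) s)
      = h :: iter d (row_gaps ds nus) t
    & valleys (size ds) (iter d (row_gaps ds nus) s)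
        + \sum_(j < d) valleys (size ds) (iter j (row_gaps ds nus) s)
      = valleys (size ds) s + \sum_(j < d) valleys (size ds) (iter j (row_gaps ds nus) t)].
Proof.
elim: d s => [|d IH] s led oks.
  have [h [t E]] : exists h t, row_gaps (0 :: ds) (n :: nus) (g :: s) = h :: t.
    by case: g => [|g] /=; [case: strip => h t|]; eexists; eexists.
  exists h, t; rewrite !big_ord0; split=> //.
  case: g E => [|g] /= E; last first.
    by case: E => _ <-; apply: valid_insert; case: (row_gaps_valid oks).
  have [okr _] := row_gaps_valid oks; move: E; have := stripP 0 okr; case: strip => h' t'.
  by move=> [okt _ _] [_ <-].
have [h [t [okt E1 E2 vt]]] := row_gaps_lower1 n g led oks.
have [okr sr] := row_gaps_valid oks; have [h' [t' [_]]] := IH _ (ltnW led) okr.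
rewrite E2 => -[<- <-]; rewrite -!iterSr => E3 vE.
have sumS u : \sum_(j < d.+1) valleys (size ds) (iter j (row_gaps ds nus) u)
    = valleys (size ds) u + \sum_(j < d) valleys (size ds) (iter j (row_gaps ds nus)
                                                            (row_gaps ds nus u)).
  by rewrite big_ord_recl; congr (_ + _); apply: eq_bigr => i _; rewrite -iterSr.
by exists h, t; split=> //; rewrite !sumS vt; lia.
Qed.

(** Conjugates rowmotion for the increments [ds] to rowmotion for zero increments,
lowering the increments to 0 from the first to the last. It leaves the first gap
alone and changes the tail independently of it, so it commutes with
[insert ds 0]; after the first increment has become 0, this insertion and the
rowmotion of the tail are all that rowmotion is made of. *)
Fixpoint straighten ds nus x : seq nat :=
  match ds, x with
  | d :: ds', g :: s => g :: straighten ds' (behead nus) (iter d (row_gaps ds' (behead nus)) s)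
  | _, _ => x
  end.

(** The function whose difference along one rowmotion step is the change of
[valleys] under [straighten]. *)
Fixpoint correction ds nus x : nat :=
  match ds, x with
  | d :: ds', g :: s =>
      \sum_(j < d) valleys (size ds') (iter j (row_gaps ds' (behead nus)) s)
        + correction ds' (behead nus) (iter d (row_gaps ds' (behead nus)) s)
  | _, _ => 0
  end.

Definition zeros (ds : seq nat) := nseq (size ds) 0.

Lemma valid_zeros ds nus x : valid ds nus x -> valid (zeros ds) nus x.
Proof. by elim=> [n g|d ds' n nus' g s _ len oks ok0]; [apply: valid_last|apply: valid_cons]. Qed.

Lemma straighten_valid ds nus x : valid ds nus x ->
  valid ds nus (straighten ds nus x) /\ sumn (straighten ds nus x) = sumn x.
Proof.
elim: ds nus x => [|d ds IH] nus x.
  by move=> /valid_nilE [n [g [-> -> ?]]]; split=> //; apply: valid_last.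
move=> /valid_consE [n [nus' [g [s [-> -> led len oks]]]]] /=.
have [oki si] := iter_row_gaps_valid d oks; have [okp sp] := IH _ _ oki.
by split; [apply: valid_cons => //|]; lia.
Qed.

Lemma straighten_inj ds nus x y : valid ds nus x -> valid ds nus y ->
  straighten ds nus x = straighten ds nus y -> x = y.
Proof.
elim: ds nus x y => [|d ds IH] nus x y //.
move=> /valid_consE [n [nus' [g [s [-> -> led len oks]]]]].
move=> /valid_consE [_ [_ [h [t [[<- <-] -> _ _ okt]]]]] /= [<-].
have [oki _] := iter_row_gaps_valid d oks; have [okj _] := iter_row_gaps_valid d okt.
move/(IH _ _ _ oki okj); rewrite -/(iter _ _ _) => E; congr (_ :: _).
elim: d E {led oki okj} => //= k IHk; have [oki _] := iter_row_gaps_valid k oks.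
have [okj _] := iter_row_gaps_valid k okt.
by move/(row_gaps_inj oki okj).
Qed.

Lemma straighten_iter_insert0 ds nus h x : valid ds nus x ->
  straighten ds nus (iter h (insert ds 0) x) = iter h (insert (zeros ds) 0) (straighten ds nus x).
Proof.
move=> okx; elim: h => //= h <-; have [+ _] := iter_insert_valid 0 h okx.
by move: (iter _ _ _) => y [].
Qed.

Lemma correction_iter_insert0 ds nus h x : valid ds nus x ->
  correction ds nus (iter h (insert ds 0) x) = correction ds nus x.
Proof.
move=> okx; elim: h => //= h <-; have [+ _] := iter_insert_valid 0 h okx.
by move: (iter _ _ _) => y [].
Qed.

Lemma delete0_straighten ds nus x : valid ds nus x -> delete ds nus 0 x = None ->
  delete (zeros ds) nus 0 (straighten ds nus x) = None.
Proof.
case=> // d ds' n nus' g s _ _ oks /=.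
have [oki si] := iter_row_gaps_valid d oks; have [_ ->] := straighten_valid oki; rewrite si.
by case: ltnP => // _; case: g.
Qed.

(** The second equation says that the valleys of [x] and of its image differ by a
coboundary, hence have the same sum over each orbit. *)
Lemma straighten_row ds nus x : valid ds nus x ->
  straighten ds nus (row_gaps ds nus x) = row_gaps (zeros ds) nus (straighten ds nus x)
  /\ valleys (size ds) (straighten ds nus x) + correction ds nus x
     = valleys (size ds) x + correction ds nus (row_gaps ds nus x).
Proof.
elim: ds nus x => [//|d ds IH] nus x.
move=> /valid_consE [n [nus' [g [s [-> -> led len oks]]]]].
have [h [t [okt Ex E0 Ev]]] := row_gaps_lower n g led oks; rewrite Ex.
have [oki _] := iter_row_gaps_valid d oks; have [okj _] := iter_row_gaps_valid d okt.
have [Er Ep] := IH _ _ oki.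
have [okr _] := row_gaps_valid oki; have [okp _] := straighten_valid oki.
set s' := iter d _ s in Ev E0 oki Er Ep okr okp; set t' := iter d _ t in Ev E0 okj.
have straighten_cons a u : straighten (d :: ds) (n :: nus') (a :: u)
  = a :: straighten ds nus' (iter d (row_gaps ds nus') u) by [].
have valleys_cons a u : valleys (size (d :: ds)) (a :: u) = (0 < a) + valleys (size ds) u by [].
have correction_cons a u : correction (d :: ds) (n :: nus') (a :: u)
  = \sum_(j < d) valleys (size ds) (iter j (row_gaps ds nus') u)
    + correction ds nus' (iter d (row_gaps ds nus') u) by [].
rewrite !straighten_cons !valleys_cons !correction_cons -/s' -/t'.
suff [-> correction_t] : h :: straighten ds nus' t'
      = row_gaps (zeros (d :: ds)) (n :: nus') (g :: straighten ds nus' s')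
    /\ correction ds nus' t' = correction ds nus' (row_gaps ds nus' s') by split=> //; lia.
case: g E0 {Ex len} => [|g] E0.
  case: (row0P 0 n oki) E0 => h1 t1 okt1 _ it dt [<- <-].
  split; last by rewrite -it (correction_iter_insert0 _ okt1).
  have [okpt _] := straighten_valid okt1.
  rewrite (@row0_eq _ (zeros ds) _ _ _ h1 (straighten ds nus' t1)) //; first exact: valid_zeros.
    by rewrite -Er -it (straighten_iter_insert0 _ okt1).
  exact: delete0_straighten.
move: E0 => /= [<- <-]; split.
  by rewrite -Er (straighten_iter_insert0 1 okr).
by rewrite (correction_iter_insert0 1 okr).
Qed.

(** * Rowmotion in a poset with labelled edges *)

(** The poset is described by coordinates in nat such that every edge [w], [y] with
label [(i, e)] raises the coordinate [e] from [i] and no other one, and such that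
an element is below everything that exceeds the labels of its incoming edges.
The part of lattice theory on which rowmotion relies follows from this. *)
Section LabelledPoset.
Context {disp : Order.disp_t} {L : finPOrderType disp} {I : eqType}.
Context (r : L -> I -> nat) (edge : L -> L -> nat -> I -> bool).
Local Open Scope order_scope.

Hypothesis edge_lt : forall w y i e, edge w y i e -> w < y.
Hypothesis lt_edge : forall x y, x < y -> exists w i e, edge x w i e /\ w <= y.
Hypothesis edge_coord : forall w y i e, edge w y i e ->
  [/\ r w e = i, (i < r y e)%N & forall e', e' <> e -> r y e' = r w e'].
Hypothesis coord_le : forall x y e, x <= y -> (r x e <= r y e)%N.
Hypothesis le_edges : forall y z,
  (forall w i e, edge w y i e -> (i < r z e)%N) -> y <= z.
Hypothesis edge_inj : forall w w' y i i' e,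
  edge w y i e -> edge w' y i' e -> w = w' /\ i = i'.

Lemma coord_leW x y : (forall e, (r x e <= r y e)%N) -> x <= y.
Proof.
move=> rxy; apply: le_edges => w i e /edge_coord[_ ltix _].
exact: leq_trans ltix (rxy e).
Qed.

Lemma edge_covers w y i e : edge w y i e -> covers w y.
Proof.
move=> ewy; rewrite /covers (edge_lt ewy); apply/negP => /existsP[z /andP[ltwz ltzy]].
have [rwe ltiy rE] := edge_coord ewy.
(* [z] has the coordinates of [w] other than [e]; if it is not below [w], then
   its coordinate [e] exceeds the label and it lies above [y] *)
suff lezw : z <= w by have := lt_le_trans ltwz lezw; rewrite ltxx.
apply: coord_leW => e'.
case: (eqVneq e' e) => [->|/eqP ne]; last first.
  by rewrite -rE //; apply/coord_le/ltW.
rewrite rwe leqNgt; apply/negP => lti.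
suff /(lt_le_trans ltzy) : y <= z by rewrite ltxx.
apply: le_edges => w' i' e1 ew'; case: (eqVneq e1 e) => [ee|/eqP ne].
  by move: ew'; rewrite ee => /(edge_inj ewy)[_ <-].
have [_ lti' _] := edge_coord ew'; apply: leq_trans lti' _.
by rewrite rE //; apply/coord_le/ltW.
Qed.

Lemma covers_edge w y : covers w y -> exists i e, edge w y i e.
Proof.
move=> /andP[ltwy /existsPn no]; have [z [i [e [ewz lezy]]]] := lt_edge ltwy.
exists i, e; have := no z; rewrite (edge_lt ewz) /= lt_def lezy andbT negbK.
by move=> /eqP->.
Qed.

(** An element below [y] whose coordinate [e] is at most [i] is below [w], as [w]
and [y] agree elsewhere. *)
Lemma edge_is_join w y i e z : edge w y i e ->
  is_join z w y = (z <= y) && (i < r z e)%N.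
Proof.
move=> ewy; have [rwe ltiy rE] := edge_coord ewy.
apply/and3P/andP => [[lezy _ /forallP jn]|[lezy lti]].
  split=> //; rewrite ltnNge; apply/negP => lei.
  have lezw : z <= w.
    apply: coord_leW => e'; case: (eqVneq e' e) => [->|/eqP ne]; first by rewrite rwe.
    by rewrite -rE //; apply: coord_le.
  have := jn w; rewrite lezw lexx /= => /(lt_le_trans (edge_lt ewy)).
  by rewrite ltxx.
split=> //; first exact: ltW (edge_lt ewy).
apply/forallP => u; apply/implyP => /andP[lezu lewu]; apply: le_edges => w' i' e' ew'.
case: (eqVneq e' e) => [ee|/eqP ne].
  move: ew'; rewrite ee => /(edge_inj ewy)[_ <-].
  exact: leq_trans lti (coord_le e lezu).
have [_ lti' _] := edge_coord ew'; apply: leq_trans lti' _.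
by rewrite rE //; apply: coord_le.
Qed.

(** An edge going down from a minimal element [j] of the set must leave the set,
hence be labelled by [e] and some [i' <= i]; any other element of the set
satisfies these labels too and so lies above [j]. *)
Lemma coord_gt_min i e y : (i < r y e)%N ->
  exists j, (i < r j e)%N /\ forall z, (i < r z e)%N -> j <= z.
Proof.
move=> lty; pose F (z : L) := #|[set u | u <= z]|.
case: (arg_minnP F (lty : (fun z => (i < r z e)%N) y)) => j ltj jmin.
exists j; split=> // z ltz; apply: le_edges => w i' e' ew.
have [rw _ rE] := edge_coord ew; have ltwj := edge_lt ew.
have lew : (r w e <= i)%N.
  rewrite leqNgt; apply/negP => /jmin; rewrite leqNgt => /negP; apply.
  apply: proper_card; apply/properP; split.
    by apply/subsetP => u; rewrite !inE => /le_trans; apply; apply: ltW.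
  by exists j; rewrite !inE ?lexx // lt_geF.
case: (eqVneq e' e) => [ee|/eqP ne]; first by rewrite -rw ee (leq_ltn_trans lew).
by move: ltj; rewrite rE ?ltnNge ?lew // => E; case: ne.
Qed.

(** The join-irreducible attached to an edge depends only on its label. *)
Lemma edge_label w y i e j : edge w y i e ->
  label w y j <-> (i < r j e)%N /\ forall z, (i < r z e)%N -> j <= z.
Proof.
move=> ewy; rewrite /label (edge_is_join _ ewy); split.
  move=> /andP[/andP[lejy ltj] /forallP jmin]; split=> // z ltz.
  have [_ lty _] := edge_coord ewy; have [k [ltk kmin]] := coord_gt_min lty.
  have := jmin k; rewrite (edge_is_join _ ewy) ltk kmin //= => lejk.
  exact: le_trans lejk (kmin _ ltz).
move=> [ltj jmin]; have [_ lty _] := edge_coord ewy.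
rewrite ltj jmin //=; apply/forallP => z; apply/implyP.
by rewrite (edge_is_join _ ewy) => /andP[_]; apply: jmin.
Qed.

(** An element is recovered as the join of its down labels. *)
Lemma down_labels_inj : injective (@down_labels _ L).
Proof.
suff le (x y : L) : down_labels x = down_labels y -> x <= y.
  by move=> x y E; apply/le_anti; rewrite !le.
move=> E; apply: le_edges => w i e ewx; have [_ ltx _] := edge_coord ewx.
have [j [ltj jmin]] := coord_gt_min ltx.
have : j \in down_labels x.
  rewrite inE; apply/existsP; exists w; rewrite (edge_covers ewx).
  by apply/(edge_label _ ewx).
rewrite E inE => /existsP[w' /andP[/covers_edge[i' [e' ewy]] /andP[/and3P[lejy _ _] _]]].
exact: leq_trans ltj (coord_le e lejy).
Qed.

Lemma rowmotion_edges x y :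
  (forall i e, (exists w, edge x w i e) <-> (exists w, edge w y i e)) ->
  rowmotion x = y.
Proof.
move=> xy; suff E : up_labels x = down_labels y.
  rewrite /rowmotion; case: pickP => [y' /eqP|/(_ y)]; last by rewrite E eqxx.
  by rewrite E => /down_labels_inj.
apply/setP => j; rewrite !inE; apply/existsP/existsP => -[w /andP[]].
  move=> /covers_edge[i [e ewy]] lj; have [w' ew'] := (xy i e).1 (ex_intro _ w ewy).
  exists w'; rewrite (edge_covers ew'); apply/(edge_label _ ew').
  exact/(edge_label _ ewy).
move=> /covers_edge[i [e ewy]] lj; have [w' ew'] := (xy i e).2 (ex_intro _ w ewy).
exists w'; rewrite (edge_covers ew'); apply/(edge_label _ ew').
exact/(edge_label _ ewy).
Qed.

Lemma ddeg_edges n (f : L -> 'I_n -> option I) y :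
  (forall i e, (exists w, edge w y i e) -> (i < n)%N) ->
  (forall i e, f y i = Some e <-> exists w, edge w y i e) ->
  ddeg y = #|[set i | f y i]|.
Proof.
move=> ltn fP; pose g (i : 'I_n) := odflt y [pick w | oapp (edge w y i) false (f y i)].
have gP i e : f y i = Some e -> edge (g i) y i e.
  rewrite /g => fi; rewrite fi /=; case: pickP => //= no.
  by have [w ew] := (fP i e).1 fi; rewrite no in ew.
have gE (i : 'I_n) e w : edge w y i e -> f y i = Some e -> g i = w.
  by move=> ew /gP eg; have [] := edge_inj eg ew.
rewrite /ddeg -(card_in_imset (f := g)) => [|i i']; last first.
  rewrite !inE; case Ei: (f y i) => [e|] //; case Ei': (f y i') => [e'|] // _ _ Eg.
  have := gP _ _ Ei; have := gP _ _ Ei'; rewrite Eg => ew' ew.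
  have [rw lty _] := edge_coord ew; have [rw' _ rE] := edge_coord ew'.
  apply/val_inj; rewrite /= -rw -rw'; congr (r _ _); apply/eqP/negPn/negP => /eqP ne.
  by move: lty; rewrite rE // rw ltnn.
apply: eq_card => w; rewrite inE; apply/idP/imsetP => [/covers_edge[i [e ew]]|[i]].
  have lti := ltn _ _ (ex_intro _ w ew).
  have fi : f y (Ordinal lti) = Some e by apply/fP; exists w.
  by exists (Ordinal lti); rewrite ?inE ?fi // (gE (Ordinal lti) e w).
rewrite inE; case Ei: (f y i) => [e|] // _ ->; exact: edge_covers (gP _ _ Ei).
Qed.

End LabelledPoset.

(** * Gap sequences and words *)

Local Notation E := false.
Local Notation N := true.

Fixpoint gaps (w : seq bool) : seq nat :=
  match w with
  | [::] => [:: 0]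
  | N :: w' => 0 :: gaps w'
  | E :: w' => (head 0 (gaps w')).+1 :: behead (gaps w')
  end.

Lemma path_of_cons g h s : path_of (g :: h :: s) = nseq g E ++ N :: path_of (h :: s).
Proof. by []. Qed.

Lemma path_of_last g : path_of [:: g] = nseq g E.
Proof. by rewrite /path_of /= cats0. Qed.

Lemma gaps_neq0 w : gaps w <> [::].
Proof. by case: w => [|[] w]. Qed.

Lemma path_of_incr_head x : x <> [::] -> path_of ((head 0 x).+1 :: behead x) = E :: path_of x.
Proof. by case: x. Qed.

Lemma gapsK : cancel gaps path_of.
Proof.
elim=> [|[] w IH] //=; last by rewrite path_of_incr_head ?IH //; apply: gaps_neq0.
by move: (@gaps_neq0 w) IH; case: (gaps w) => // h s _ <-.
Qed.

Lemma gaps_nseq g w : gaps (nseq g E ++ w) = (g + head 0 (gaps w)) :: behead (gaps w).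
Proof. by elim: g => [|g IH] /=; [case: (gaps w) (@gaps_neq0 w) | rewrite IH]. Qed.

Lemma path_ofK x : x <> [::] -> gaps (path_of x) = x.
Proof.
elim: x => // g [|h s] IH _.
  by rewrite path_of_last -[nseq _ _]cats0 gaps_nseq /= addn0.
by rewrite path_of_cons gaps_nseq /= IH // addn0.
Qed.

Lemma count_N_path_of x : count_mem N (path_of x) = (size x).-1.
Proof.
elim: x => // g [|h s] IH; first by rewrite path_of_last count_nseq /= mul0n.
by rewrite path_of_cons count_cat count_nseq /= IH mul0n.
Qed.

Lemma count_E_path_of x : count_mem E (path_of x) = sumn x.
Proof.
elim: x => // g [|h s] IH; first by rewrite path_of_last count_nseq /= mul1n addn0.
by rewrite path_of_cons count_cat count_nseq /= -/(path_of _) IH mul1n.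
Qed.

Lemma size_path_of x : size (path_of x) = sumn x + (size x).-1.
Proof.
rewrite -count_N_path_of -count_E_path_of -(count_predC (pred1 E)); congr (_ + _).
by apply: eq_count => -[].
Qed.

(** The [i.+1]-st north step, if there is one, is at position
[sumn (take i.+1 x) + i]. *)
Lemma count_N_take x k i : (i < count_mem N (take k (path_of x)))
  = (i.+1 < size x) && (sumn (take i.+1 x) + i < k).
Proof.
elim: x k i => [|g [|h s] IH] k i; first by rewrite /= ltn0.
  rewrite path_of_last; apply/negbTE; rewrite -leqNgt.
  apply: leq_trans (leq_count_subseq _ (take_subseq _ _)) _.
  by rewrite count_nseq /= mul0n.
rewrite path_of_cons take_cat size_nseq; case: (ltnP k g) => [ltkg|legk].
  rewrite (take_nseq _ (ltnW ltkg)) count_nseq /= mul0n ltn0; apply/esym/negbTE.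
  by rewrite negb_and -!leqNgt; apply/orP; right; lia.
rewrite count_cat count_nseq mul0n add0n.
case Ek: (k - g) => [|k'] /=; first by apply/esym/negbTE; lia.
case: i => [|i] /=; first by lia.
have := IH k' i; rewrite /= -!/(path_of _) => IHi.
by rewrite add1n ltnS IHi; lia.
Qed.

Lemma weakly_aboveP x y : size x = size y -> sumn x = sumn y ->
  weakly_above (path_of x) (path_of y)
  <-> forall i, i < size x -> sumn (drop i y) <= sumn (drop i x).
Proof.
move=> sxy sumxy; have sumE z i : sumn (take i z) + sumn (drop i z) = sumn z.
  by rewrite -sumn_cat cat_take_drop.
split=> [/forallP wa [|i] lti|dr]; first by rewrite !drop0 sumxy.
  have ltk : sumn (take i.+1 y) + i.+1 < (size (path_of y)).+1.
    by rewrite size_path_of -sxy; have := sumE y i.+1; lia.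
  have ci : i < count_mem N (take (sumn (take i.+1 y) + i.+1) (path_of y)).
    by rewrite count_N_take -sxy lti; lia.
  have := leq_trans ci (wa (Ordinal ltk)); rewrite count_N_take lti /=.
  by have := sumE x i.+1; have := sumE y i.+1; lia.
apply/forallP => k; case Ec: (count_mem N (take k (path_of y))) => [|i] //.
have : i < count_mem N (take k (path_of y)) by rewrite Ec.
rewrite !count_N_take -sxy => /andP[lti lek]; rewrite lti /=.
by have := sumE x i.+1; have := sumE y i.+1; have := dr _ lti; lia.
Qed.

Lemma validP ds nu x : size nu = (size ds).+1 -> size x = size nu ->
  (forall i, i < size ds -> nth 0 ds i <= nth 0 nu i.+1) ->
  valid ds nu x <-> forall i, i < size x -> sumn (drop i nu) <= sumn (drop i x).
Proof.
elim: ds nu x => [|d ds IH] [|n nu] [|g x] //= [snu] [sx] inc.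
  move/size0nil: snu sx => -> /size0nil ->; split=> [/valid_sumn le [|i] //|/(_ 0 isT)] /=.
  by rewrite !addn0; apply: valid_last.
have {}IH := IH nu x snu sx (fun i => inc i.+1); split.
  move=> okx; have [_ [_ [_ [_ [[<- <-] [<- <-] _ le /IH okx']]]]] := valid_consE okx.
  by case=> [|i] //= lti; apply: okx'.
move=> dr; apply: valid_cons; first by have := inc 0 isT; rewrite /= nth0.
  exact: (dr 0).
by apply/IH => i; apply: (dr i.+1).
Qed.

Lemma valid_size ds nu x : valid ds nu x -> size x = (size ds).+1.
Proof. by elim=> //= d ds' n nus g s _ _ _ ->. Qed.

Lemma dyck_valid ds nu w : size nu = (size ds).+1 ->
  (forall i, i < size ds -> nth 0 ds i <= nth 0 nu i.+1) ->
  dyck nu w <-> valid ds nu (gaps w) /\ sumn (gaps w) = sumn nu.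
Proof.
move=> snu inc; rewrite /dyck -{1 2 3}(gapsK w) !count_E_path_of !count_N_path_of.
have sg : 0 < size (gaps w) by case: (gaps w) (@gaps_neq0 w).
split.
  move=> /and3P[/eqP sumE /eqP sizeE wa]; split=> //.
  have sE : size (gaps w) = size nu by rewrite -(prednK sg) sizeE snu.
  by apply/validP => //; apply/weakly_aboveP.
move=> [okw sumE]; have sE : size (gaps w) = size nu by rewrite (valid_size okw).
by rewrite sumE sE !eqxx /=; apply/weakly_aboveP => //; apply/(validP snu).
Qed.

(** * Rotations of words *)

Section Altitude.
Import GRing.Theory.
Local Open Scope ring_scope.

Lemma altitude0 ds w : altitude ds w 0 = 0.
Proof. by rewrite /altitude take0 /= big_ord0. Qed.

Lemma altitude_cons ds b w k : altitude ds (b :: w) k.+1 =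
  (if b then Posz (nth 0%N ds 0) + altitude (behead ds) w k else altitude ds w k - 1).
Proof.
case: b; rewrite /altitude /=; last by rewrite add0n add1n; lia.
rewrite add0n add1n big_ord_recl PoszD -addrA; congr (_ + (Posz _ - _)).
by apply: eq_bigr => i _; rewrite nth_behead.
Qed.

Definition first_at ds w (a : int) p :=
  [/\ (p <= size w)%N, altitude ds w p = a & forall l, (l < p)%N -> altitude ds w l <> a].

Lemma first_at_uniq ds w a p q : first_at ds w a p -> first_at ds w a q -> p = q.
Proof.
move=> [_ ap np] [_ aq nq]; case: (ltngtP p q) => // [/nq|/np] //.
Qed.

Lemma first_at_cons ds b w a p :
  (if b then Posz (nth 0%N ds 0) else - 1) + a <> 0 ->
  first_at (if b then behead ds else ds) w a p ->
  first_at ds (b :: w) ((if b then Posz (nth 0%N ds 0) else - 1) + a) p.+1.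
Proof.
move=> ne [lep ap np]; split=> //.
  by rewrite altitude_cons -ap; case: (b); rewrite // addrC.
case=> [|l] ltl; first by rewrite altitude0 => E; case: ne.
rewrite altitude_cons => E; apply: (np l) => //; move: E.
by case: (b); lia.
Qed.

Lemma rotationP ds mu mu' : rotation ds mu mu' <-> exists k m,
  [/\ nth N mu k = E, nth E mu k.+1 = N, (k.+1 < m <= size mu)%N,
      altitude ds mu m = altitude ds mu k.+1 /\
      (forall l, (k.+1 < l < m)%N -> altitude ds mu l <> altitude ds mu k.+1)
    & mu' = take k mu ++ drop k.+1 (take m mu) ++ E :: drop m mu].
Proof.
split.
  move=> /existsP[k /existsP[m /and5P[/eqP vk /eqP vk1 ltm /eqP am /andP[/forallP nm /eqP->]]]].
  exists k, m; split=> //; first by rewrite ltm /= -ltnS.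
  split=> // l ltl; have lts : (l < size mu)%N by have := ltn_ord m; lia.
  by have := nm (Ordinal lts); rewrite /= ltl => /eqP.
move=> [k [m [vk vk1 /andP[ltm lem] [am nm] ->]]].
have ltk : (k < size mu)%N by lia.
apply/existsP; exists (Ordinal ltk); apply/existsP.
exists (Ordinal (lem : m < (size mu).+1)%N); rewrite /= vk vk1 ltm am !eqxx /= andbT.
by apply/forallP => l; apply/implyP => /nm/eqP.
Qed.

(** A rotation of a word happens either at its first two steps or inside its tail.
In the former case the altitude of the valley is reached again where the word
after the north step has lost the units opened by that step. *)
Lemma rotation_cons ds b w mu' : rotation ds (b :: w) mu' <->
  (exists w' p, [/\ b = E, w = N :: w', first_at (behead ds) w' (- Posz (nth 0%N ds 0)) p
      & mu' = N :: take p w' ++ E :: drop p w'])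
  \/ (exists2 mu'', mu' = b :: mu'' & rotation (if b then behead ds else ds) w mu'').
Proof.
rewrite rotationP; split.
  move=> [[|k] [m [vk vk1 /andP[ltm lem] [am nm] ->]]]; last first.
    right; case: m ltm lem am nm => // m ltm lem am nm.
    exists (take k w ++ drop k.+1 (take m w) ++ E :: drop m w) => //.
    apply/rotationP; exists k, m; split=> //; first by apply/andP.
    split; first by move: am; rewrite !altitude_cons; case: (b); lia.
    by move=> l ltl; have := nm l.+1; rewrite !altitude_cons; case: (b) => /(_ ltl); lia.
  left; move: vk vk1 ltm lem am nm => /= -> {b}; case: w => // -[] // w' _.
  case: m => [|[|p]] // _ lep; rewrite !altitude_cons altitude0 => am nm.
  exists w', p; split=> //.
  split=> //; first by lia.
  by move=> l ltl; have := nm l.+2; rewrite !altitude_cons => /(_ ltl); lia.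
move=> [[w' [p [-> -> [lep ap np] ->]]]|[mu'' -> /rotationP]].
  exists 0%N, p.+2; split=> //.
  split; first by rewrite !altitude_cons altitude0 ap; lia.
  case=> [|[|l]] // ltl; rewrite !altitude_cons altitude0 => al.
  by apply: (np l) => //; lia.
move=> [k [m [vk vk1 ltm [am nm] ->]]]; exists k.+1, m.+1; split=> //.
split; first by rewrite !altitude_cons; move: am; case: (b) => ->.
case=> // l ltl; rewrite !altitude_cons => al; apply: (nm l) => //.
by move: al; case: (b); lia.
Qed.

(** Altitude [- m] is reached for the first time right after the [m]-th base-level
step, so inserting an east step there is what a rotation does to the part of
the path after its north step. *)
Lemma first_at_insert ds nu m x : valid ds nu x -> (m + sumn (behead nu) <= sumn x)%N ->
  exists2 p, first_at ds (path_of x) (- Posz m) p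
    & path_of (insert ds m x) = take p (path_of x) ++ E :: drop p (path_of x).
Proof.
have pre g w ds' k : (k <= g)%N -> altitude ds' (nseq g E ++ w) k = - Posz k.
  elim: g k => [|g IH] [|k] // lek; rewrite ?altitude0 // altitude_cons IH //; lia.
have fa g w ds' k : (k <= g)%N -> first_at ds' (nseq g E ++ w) (- Posz k) k.
  move=> lek; split; first by rewrite size_cat size_nseq; lia.
    exact: pre.
  by move=> l ltl; rewrite pre; lia.
have fs g k w ds' p : (0 < k)%N -> first_at ds' w (- Posz k) p ->
    first_at ds' (nseq g E ++ w) (- Posz (k + g)) (g + p).
  move=> lt0k fk; elim: g => [|g IHg]; first by rewrite addn0.
  have -> : - Posz (k + g.+1) = - 1 + - Posz (k + g) by lia.
  by rewrite addSn; apply: (@first_at_cons _ E) => //=; lia.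
have tk g w k : (k <= g)%N ->
    nseq g.+1 E ++ w = take k (nseq g E ++ w) ++ E :: drop k (nseq g E ++ w).
  elim: k g => [|k IHk] g; first by rewrite take0 drop0.
  by case: g => // g lek; rewrite /= -IHk.
move=> okx; elim: okx m => [n g le_ng|d ds' n nu' g s led len oks IH] m lem.
  exists m; rewrite path_of_last -[nseq g E]cats0; first by apply: fa; move: lem => /=; lia.
  by rewrite -tk ?path_of_last ?cats0 //; move: lem => /=; lia.
have [h [s' Es]] : exists h s', s = h :: s' by case: oks => *; eexists; eexists.
have pc a u : u <> [::] -> path_of (a :: u) = nseq a E ++ N :: path_of u by case: u.
have ns : s <> [::] by rewrite Es.
rewrite (pc _ _ ns) /=; case: (leqP m g) => [lemg|ltgm].
  by exists m; [apply: fa | rewrite (pc _ _ ns) -tk].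
have nins : insert ds' (m - g + d) s <> [::].
  by move=> E0; have := sumn_insert (m - g + d) oks; rewrite E0.
have [|p fp Ep] := IH (m - g + d)%N.
  by have := sumn_head nu'; move: lem => /=; lia.
exists (g + p.+1)%N; last first.
  rewrite (pc _ _ nins) Ep take_cat drop_cat size_nseq.
  by rewrite ltnNge leq_addr /= addKn /= -catA.
have {fp} : first_at (d :: ds') (N :: path_of s) (- Posz (m - g)) p.+1.
  have -> : - Posz (m - g) = Posz d + - Posz (m - g + d) by lia.
  by apply: (@first_at_cons _ N) => //=; lia.
have -> : - Posz m = - Posz (m - g + g) by lia.
by apply: fs; lia.
Qed.

Lemma rotation_rotate ds nu x mu' : valid ds nu x -> rotation ds (path_of x) mu' <->
  exists i e, up_label ds x i = Some e /\ mu' = path_of (rotate ds i x).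
Proof.
have pc a u : u <> [::] -> path_of (a :: u) = nseq a E ++ N :: path_of u by case: u.
have ncons (u : seq nat) : size u <> 0%N -> u <> [::] by case: u.
move=> okx; elim: okx mu' => [n g le_ng|d ds' n nu' g s led len oks IH] mu'.
  rewrite path_of_last; split=> [|[i [e []]] //].
  elim: g {le_ng} mu' => [|g IHg] mu'; first by case/rotationP => k [m [] //]; rewrite nth_nil.
  move/rotation_cons => [[w' [p [_ E0 _ _]]]|[mu'' _ /IHg [i [e []]]] //].
  by case: g E0 {IHg}.
have ns : s <> [::] by apply: ncons; rewrite (valid_size oks).
have [|p fp Ep] := first_at_insert (m := d) oks.
  by have := valid_head oks; lia.
have ni : insert ds' d s <> [::] by move=> E0; have := sumn_insert d oks; rewrite E0.
have split_g h mu : rotation (d :: ds') (nseq h E ++ N :: path_of s) mu <->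
    ((0 < h)%N /\ mu = nseq h.-1 E ++ N :: path_of (insert ds' d s)) \/
    (exists2 mu'', mu = nseq h E ++ N :: mu'' & rotation ds' (path_of s) mu'').
  elim: h mu => [|h IHh] mu.
    rewrite /= rotation_cons; split=> [[[? [? []]]|]|[[]|]] // H; [by right|by right].
  rewrite /= rotation_cons; split.
    move=> [[w' [q [_ Ew fq ->]]]|[mu'' -> /IHh [[lth ->]|[mu3 -> r3]]]].
    - left; split=> //; case: h Ew {IHh} => [|h] //= [Ew]; rewrite -Ew in fq *.
      by rewrite (first_at_uniq fq fp) Ep.
    - by left; split=> //; case: h lth {IHh}.
    by right; exists mu3.
  move=> [[_ ->]|[mu3 -> r3]]; last first.
    by right; exists (nseq h E ++ N :: mu3) => //; apply/IHh; right; exists mu3.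
  case: h IHh => [|h] IHh; first by left; exists (path_of s), p; rewrite Ep.
  right; exists (nseq h E ++ N :: path_of (insert ds' d s)) => //.
  by apply/IHh; left.
rewrite (pc _ _ ns) split_g; split.
  move=> [[lt0g ->]|[mu'' -> /IH [i [e [ui ->]]]]].
    by exists 0%N, (0%N, g.-1); rewrite /= lt0g (pc _ _ ni).
  exists i.+1, (outer_id d g e); rewrite /= ui (pc _ (rotate ds' i s)) //; apply: ncons.
  by have [oku _] := rotate_valid oks ui; rewrite (valid_size oku).
move=> [[|i] [e []]] /=.
  by case: ltnP => // lt0g _ ->; left; rewrite (pc _ _ ni).
case ui: up_label => [e'|] //= _ ->; right; exists (path_of (rotate ds' i s)).
  by rewrite pc //; apply: ncons; have [oku _] := rotate_valid oks ui; rewrite (valid_size oku).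
by apply/IH; exists i, e'.
Qed.

End Altitude.

(** * The alt nu-Tamari poset *)

Definition gap_seq (nu : seq nat) (x : dyck_path nu) : seq nat := gaps (val x).

Lemma gap_seq_inj nu : injective (@gap_seq nu).
Proof. by move=> x y /(can_inj gapsK) E; do 2!apply: val_inj. Qed.

Lemma card_up_label ds nu x : valid ds nu x ->
  #|[set i : 'I_(size ds) | up_label ds x i]| = valleys (size ds) x.
Proof.
rewrite -sum1dep_card big_mkcond /=.
move=> okx; elim: okx => [n g _|d ds' n nu' g s _ _ _ IH]; first by rewrite big_ord0.
rewrite big_ord_recl [size _]/= /valleys /= -/(valleys _ _) -IH; congr (_ + _).
  by case: (0 < g).
by apply: eq_bigr => i _; case: up_label.
Qed.

Lemma down_label_lt_size ds nu y i e : down_label ds nu y i = Some e -> i < size ds.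
Proof.
elim: ds nu y i e => [|d ds IH] nu [|g s] [|i] e //=.
by case Ei: down_label => [e'|] // _; apply: IH Ei.
Qed.

Section Tam.
Context (n : nat) (nu : n.+1.-tuple nat) (delta : n.-tuple nat).
Hypothesis inc : increment_vector nu delta.
Implicit Types x y z w : Tam nu delta.

Let inc_nth i : i < size delta -> nth 0 delta i <= nth 0 nu i.+1.
Proof.
rewrite size_tuple => lti; have := forallP inc (Ordinal lti).
by rewrite !(tnth_nth 0) lift0.
Qed.

Let size_nu : size nu = (size delta).+1. Proof. by rewrite !size_tuple. Qed.

Lemma gap_seq_valid (x : dyck_path nu) : valid delta nu (gap_seq x).
Proof. by have /(dyck_valid _ size_nu inc_nth)[] := valP x. Qed.

Lemma sumn_gap_seq (x : dyck_path nu) : sumn (gap_seq x) = sumn nu.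
Proof. by have /(dyck_valid _ size_nu inc_nth)[] := valP x. Qed.

Lemma gap_seq_ex l : valid delta nu l -> sumn l = sumn nu -> exists x : dyck_path nu, gap_seq x = l.
Proof.
move=> okl sl; have nl : l <> [::] by move=> l0; have := valid_size okl; rewrite l0.
have dl : dyck nu (path_of l) by apply/(dyck_valid _ size_nu inc_nth); rewrite path_ofK.
have szl : size (path_of l) == size (path_of nu).
  by rewrite !size_path_of sl (valid_size okl) size_nu.
by exists (exist _ (Tuple szl) dl); rewrite /gap_seq /= path_ofK.
Qed.

Definition edge x y i e :=
  (up_label delta (gap_seq x) i == Some e) && (gap_seq y == rotate delta i (gap_seq x)).

Lemma edgeP x y : reflect (exists i e, edge x y i e) (Tam_rot x y).
Proof.
have path_gap (z : Tam nu delta) : Tam_path z = path_of (gap_seq z) by rewrite /gap_seq gapsK.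
apply: (iffP idP); rewrite /Tam_rot.
  rewrite path_gap => /(rotation_rotate _ (gap_seq_valid x))[i [e [ui Ey]]].
  exists i, e; rewrite /edge ui eqxx /= {1}/gap_seq -/(Tam_path y) Ey path_ofK //.
  move=> u0; have [oku _] := rotate_valid (gap_seq_valid x) ui.
  by have := valid_size oku; rewrite u0.
move=> [i [e /andP[/eqP ui /eqP Ey]]]; rewrite path_gap.
by apply/(rotation_rotate _ (gap_seq_valid x)); exists i, e; rewrite path_gap Ey.
Qed.

Let r x e := norths_before delta (gap_seq x) e.

Lemma edge_coord x y i e : edge x y i e ->
  [/\ r x e = i, i < r y e & forall e', e' <> e -> r y e' = r x e'].
Proof.
by move=> /andP[/eqP ui /eqP Ey]; rewrite /r Ey; apply: norths_before_rotate (gap_seq_valid x) ui.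
Qed.

Lemma edge_lt x y i e : edge x y i e -> (x < y)%O.
Proof.
move=> exy; rewrite lt_neqAle; apply/andP; split; last first.
  by apply: connect1; apply/edgeP; exists i, e.
by apply/eqP => Exy; have [rx + _] := edge_coord exy; rewrite -Exy rx ltnn.
Qed.

Lemma lt_edge x y : (x < y)%O -> exists w i e, edge x w i e /\ (w <= y)%O.
Proof.
rewrite lt_neqAle => /andP[ne /connectP[[|w p] /= pth Ey]]; first by rewrite Ey eqxx in ne.
move: pth => /andP[/edgeP[i [e exw]] pth]; exists w, i, e; split=> //.
by apply/connectP; exists p.
Qed.

Lemma norths_before_le x y e : (x <= y)%O -> r x e <= r y e.
Proof.
move=> /connectP[p]; elim: p x => [|w p IH] x /=; first by move=> _ ->.
move=> /andP[/edgeP[i [e' exw]] /IH H /H]; apply: leq_trans.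
have [rx lti rE] := edge_coord exw; case: (eqVneq e e') => [->|/eqP ne].
  by rewrite rx ltnW.
by rewrite rE.
Qed.

Lemma down_labelP y i e :
  down_label delta nu (gap_seq y) i = Some e <-> exists w, edge w y i e.
Proof.
split=> [/(down_label_ex (gap_seq_valid y))[l [okl sl ul upl]]|[w /andP[/eqP uw /eqP->]]].
  have [|w Ew] := gap_seq_ex okl; first by rewrite sl sumn_gap_seq.
  by exists w; rewrite /edge Ew ul upl !eqxx.
exact: down_label_rotate (gap_seq_valid w) uw.
Qed.

Lemma up_labelP x i e : up_label delta (gap_seq x) i = Some e <-> exists w, edge x w i e.
Proof.
split=> [ui|[w /andP[/eqP]] //]; have [oku su] := rotate_valid (gap_seq_valid x) ui.
have [|w Ew] := gap_seq_ex oku; first by rewrite su sumn_gap_seq.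
by exists w; rewrite /edge ui Ew !eqxx.
Qed.

Lemma reach_le y z : reach delta (gap_seq y) (gap_seq z) -> (y <= z)%O.
Proof.
move Ey: (gap_seq y) => l; move Ez: (gap_seq z) => l' rl.
elim: rl y Ey Ez => {l l'} [l|l i e l' ui _ IH] y Ey Ez.
  by have -> : y = z by apply: gap_seq_inj; rewrite Ey Ez.
have [w eyw] := (up_labelP y i e).1 (etrans (congr1 (up_label delta ^~ i) Ey) ui).
have := eyw => /andP[_ /eqP Ew]; apply: le_trans (IH w _ Ez); last by rewrite Ew Ey.
exact: ltW (edge_lt eyw).
Qed.

Lemma le_edges y z : (forall w i e, edge w y i e -> i < r z e) -> (y <= z)%O.
Proof.
move=> H; apply: reach_le; apply: (reach_down_label (gap_seq_valid y) (gap_seq_valid z)).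
  by rewrite !sumn_gap_seq.
by move=> i e /down_labelP[w /H].
Qed.

Lemma edge_inj w w' y i i' e : edge w y i e -> edge w' y i' e -> w = w' /\ i = i'.
Proof.
move=> ew ew'; have dw := (down_labelP y i e).2 (ex_intro _ w ew).
have dw' := (down_labelP y i' e).2 (ex_intro _ w' ew').
have Ei := down_label_pos_inj (gap_seq_valid y) dw dw'; subst i'; split=> //.
move: ew ew' => /andP[/eqP uw /eqP Ew] /andP[/eqP uw' /eqP Ew'].
by apply/gap_seq_inj/(rotate_inj (gap_seq_valid w) (gap_seq_valid w') uw uw'); rewrite -Ew -Ew'.
Qed.

Lemma gap_seq_rowmotion x : gap_seq (rowmotion x) = row_gaps delta nu (gap_seq x).
Proof.
have [okr sr] := row_gaps_valid (gap_seq_valid x).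
have [|y Ey] := gap_seq_ex okr; first by rewrite sr sumn_gap_seq.
suff -> : rowmotion x = y by [].
apply: (rowmotion_edges edge_lt lt_edge edge_coord norths_before_le le_edges edge_inj) => i e.
rewrite -up_labelP -(down_labelP (y : Tam nu delta)) Ey.
by rewrite (down_label_row _ (gap_seq_valid x)).
Qed.

Lemma ddeg_rowmotion x : ddeg (rowmotion x) = valleys (size delta) (gap_seq x).
Proof.
rewrite -(card_up_label (gap_seq_valid x)).
rewrite (ddeg_edges edge_lt lt_edge edge_coord norths_before_le le_edges edge_inj
  (f := fun y (i : 'I_(size delta)) => down_label delta nu (gap_seq y) i)).
- by apply: eq_card => i; rewrite !inE gap_seq_rowmotion (down_label_row _ (gap_seq_valid x)).
- by move=> i e /down_labelP/down_label_lt_size.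
- by move=> i e; apply: down_labelP.
Qed.

Lemma rowmotion_inj : injective (@rowmotion _ (Tam nu delta)).
Proof.
move=> x y E; apply: gap_seq_inj; apply: (row_gaps_inj (gap_seq_valid x) (gap_seq_valid y)).
by rewrite -!gap_seq_rowmotion E.
Qed.

Definition straighten_path (x : dyck_path nu) : dyck_path nu :=
  odflt x [pick y | gap_seq y == straighten delta nu (gap_seq x)].

Lemma gap_straighten_path x : gap_seq (straighten_path x) = straighten delta nu (gap_seq x).
Proof.
rewrite /straighten_path; case: pickP => [y /eqP //|no].
have [okp sp] := straighten_valid (gap_seq_valid x).
have [|y Ey] := gap_seq_ex okp; first by rewrite sp sumn_gap_seq.
by have := no y; rewrite Ey eqxx.
Qed.

Lemma straighten_path_inj : injective straighten_path.
Proof.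
move=> x y E; apply: gap_seq_inj; apply: (straighten_inj (gap_seq_valid x) (gap_seq_valid y)).
by rewrite -!gap_straighten_path E.
Qed.

End Tam.

(** * Conjugating the two rowmotions *)

(** An injective map permutes each of its orbits. *)
Lemma sum_orbit_shift (T : finType) (f : T -> T) (F : T -> nat) x : injective f ->
  \sum_(y <- orbit f x) F (f y) = \sum_(y <- orbit f x) F y.
Proof.
move=> injf; rewrite -(big_map f predT F); apply: perm_big; apply: uniq_perm.
- by rewrite (map_inj_uniq injf) orbit_uniq.
- exact: orbit_uniq.
move=> y; apply/mapP/idP => [[z + ->]|].
  by rewrite -!fconnect_orbit => /connect_trans; apply; apply: fconnect1.
rewrite -fconnect_orbit => xy; exists (finv f y); last by rewrite f_finv.
rewrite -fconnect_orbit; apply: connect_trans xy _.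
by rewrite fconnect_sym // -{2}(f_finv injf y) fconnect1.
Qed.

Theorem theorem1p1 (n : nat) (nu : n.+1.-tuple nat) (delta delta' : n.-tuple nat)
    (hdelta : increment_vector nu delta) (hdelta' : increment_vector nu delta') :
  exists Phi : Tam nu delta -> Tam nu delta',
    [/\ bijective Phi,
        forall x : Tam nu delta, Phi (rowmotion x) = rowmotion (Phi x)
      & forall x : Tam nu delta, \sum_(y <- orbit rowmotion x) ddeg y
                = \sum_(y <- orbit rowmotion x) ddeg (Phi y)].
Proof.
have inj := straighten_path_inj hdelta; have inj' := straighten_path_inj hdelta'.
pose Phi (x : Tam nu delta) : Tam nu delta' := invF inj' (straighten_path delta x).
have gapPhi x : straighten delta' nu (gap_seq (Phi x)) = straighten delta nu (gap_seq x).
  by rewrite -(gap_straighten_path hdelta') f_invF (gap_straighten_path hdelta).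
have szd : size delta' = size delta by rewrite !size_tuple.
have zd : zeros delta' = zeros delta by rewrite /zeros szd.
have PhiR x : Phi (rowmotion x) = rowmotion (Phi x).
  apply: gap_seq_inj; apply: (straighten_inj (gap_seq_valid hdelta' _) (gap_seq_valid hdelta' _)).
  rewrite gapPhi !(gap_seq_rowmotion hdelta, gap_seq_rowmotion hdelta').
  have [-> _] := straighten_row (gap_seq_valid hdelta x).
  by have [-> _] := straighten_row (gap_seq_valid hdelta' (Phi x)); rewrite gapPhi zd.
exists Phi; split=> //.
  exists (fun y => invF inj (straighten_path delta' y)) => x.
    by rewrite /Phi f_invF invF_f.
  by rewrite /Phi f_invF invF_f.
move=> x; have injR := rowmotion_inj hdelta.
rewrite -[LHS](sum_orbit_shift _ _ injR) -[RHS](sum_orbit_shift (fun y => ddeg (Phi y)) _ injR).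
under eq_bigr do rewrite (ddeg_rowmotion hdelta).
under [RHS]eq_bigr do rewrite PhiR (ddeg_rowmotion hdelta').
pose B (y : Tam nu delta) := correction delta nu (gap_seq y).
pose B' y := correction delta' nu (gap_seq (Phi y)).
pose V (y : Tam nu delta) := valleys (size delta) (straighten delta nu (gap_seq y)).
(* the statistics of y and of Phi y are both compared with [V], the one of the
   path with zero increments to which y and Phi y are conjugated *)
have B1 : \sum_(y <- orbit rowmotion x) (V y + B y)
    = \sum_(y <- orbit rowmotion x) (valleys (size delta) (gap_seq y) + B (rowmotion y)).
  apply: eq_bigr => y _; rewrite /B (gap_seq_rowmotion hdelta).
  by case: (straighten_row (gap_seq_valid hdelta y)).
have B2 : \sum_(y <- orbit rowmotion x) (V y + B' y)
    = \sum_(y <- orbit rowmotion x) (valleys (size delta') (gap_seq (Phi y)) + B' (rowmotion y)).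
  apply: eq_bigr => y _; rewrite /B' /V PhiR (gap_seq_rowmotion hdelta') -gapPhi -szd.
  by case: (straighten_row (gap_seq_valid hdelta' (Phi y))).
move: B1 B2; rewrite !big_split /= (sum_orbit_shift B _ injR) (sum_orbit_shift B' _ injR).
by move=> /addIn <- /addIn.
Qed.
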